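(* Let $(M,I,J,K)$ be a compact hypercomplex manifold satisfying the $\partial\partial_J$-lemma. Then the differential graded algebra $(A^{\bullet,0}(M),\partial)$ is formal.
   Context: A hypercomplex manifold $(M,I,J,K)$ is a smooth manifold with three (integrable) complex structures that pairwise anticommute and satisfy $IJ=K$. $A^{p,q}(M)$ denotes smooth complex $(p,q)$-forms with respect to $I$, and $\partial,\bar\partial$ are the Dolbeault operators of $I$. $J$ acts on $k$-forms by $(J\alpha)(X_1,\dots,X_k)=\alpha(JX_1,\dots,JX_k)$, and $\partial_J:=J^{-1}\bar\partial J\colon A^{p,0}(M)\to A^{p+1,0}(M)$; $\partial$ and $\partial_J$ square to zero and anticommute. The $\partial\partial_J$-lemma holds on $M$ if, on $A^{p,0}(M)$ for all $p$, $\mathrm{Im}\,\partial\cap\ker\partial_J=\mathrm{Im}\,\partial\partial_J$ and $\mathrm{Im}\,\partial_J\cap\ker\partial=\mathrm{Im}\,\partial\partial_J$. A morphism of differential graded algebras (DGAs) over $\mathbb{C}$ is a $\mathbb{C}$-linear, degree-preserving, multiplicative map commuting with differentials; it is a quasi-isomorphism if it induces an isomorphism in cohomology. Two DGAs are equivalent if they are connected by a finite zigzag of quasi-isomorphisms. A DGA is formal if it is equivalent to a DGA with zero differential. $(A^{\bullet,0}(M),\partial)$ is a DGA with the wedge product. *)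

(* Defs.v *)
From HB Require Import structures.
From mathcomp Require Import all_boot all_order all_algebra.
From mathcomp Require Import complex.
From mathcomp Require Import boolp classical_sets functions cardinality reals.
From mathcomp Require Import topology normedtype derive.
From mathcomp Require Import ring.

Set Implicit Arguments.
Unset Strict Implicit.
Unset Printing Implicit Defensive.

Import Order.TTheory GRing.Theory Num.Theory.
Import numFieldNormedType.Exports.

Local Open Scope classical_set_scope.
Local Open Scope ring_scope.

Section Smoothness.
Variables (R : realType) (n : nat).
Local Notation E := 'rV[R]_n.

Fixpoint Ck (k : nat) (U : set E) (f : E -> R) : Prop :=
  (forall x, U x -> {for x, continuous f}) /\
  if k is k'.+1 then
    forall i : 'I_n,
      (forall x, U x -> derivable f x (delta_mx 0 i)) /\
      Ck k' U (fun x => 'D_(delta_mx 0 i) f x)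
  else True.

Definition smooth_on (U : set E) (f : E -> R) : Prop := forall k, Ck k U f.

Lemma Ck_continuous k U f : Ck k U f -> forall x, U x -> {for x, continuous f}.
Proof. by case: k => [|k] []. Qed.

Lemma CkW k U f : Ck k.+1 U f -> Ck k U f.
Proof.
elim: k f => [|k IH] f; first by case.
by move=> [fc fd]; split=> // i; have [d1 d2] := fd i; split=> //; apply: IH.
Qed.

Lemma eq_Ck k U f g : open U -> (forall x, U x -> f x = g x) ->
  Ck k U f -> Ck k U g.
Proof.
move=> oU; have near_fg (f' g' : E -> R) x : (forall x, U x -> f' x = g' x) -> U x ->
    \near x, f' x = g' x.
  by move=> fg Ux; apply: filterS (open_nbhs_nbhs (conj oU Ux)) => y; apply: fg.
have cont (f' g' : E -> R) x : (forall x, U x -> f' x = g' x) -> U x ->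
    {for x, continuous f'} -> {for x, continuous g'}.
  move=> fg Ux fc; rewrite /prop_for /continuous_at -(fg _ Ux).
  apply: cvg_trans fc; apply: (@near_eq_cvg _ _ (nbhs x)).
  by apply: (near_fg _ _ _ _ Ux) => y Uy; rewrite fg.
elim: k f g => [|k IH] f g fg [fc fd].
  by split=> // x Ux; apply: cont (fc x Ux).
split=> [x Ux|i]; first exact: cont (fc x Ux).
have [d1 d2] := fd i; split.
    by by move=> x Ux; apply: near_eq_derivable (d1 x Ux); exact: near_fg.
  apply: IH d2 => x Ux; apply: near_eq_derive; exact: near_fg.
Qed.

Lemma Ck_cst k U (c : R) : open U -> Ck k U (cst c).
Proof.
move=> oU; elim: k c => [|k IH] c.
  by split=> // x _; exact: cst_continuous.
split=> [x _|i]; first exact: cst_continuous.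
split=> [x _|]; first exact: derivable_cst.
by apply: (@eq_Ck _ _ (cst 0)) => // x _; rewrite derive_cst.
Qed.

Lemma CkD k U f g : open U -> Ck k U f -> Ck k U g -> Ck k U (f + g).
Proof.
move=> oU; elim: k f g => [|k IH] f g [fc fd] [gc gd].
  by split=> // x Ux; apply: continuousD; [exact: fc|exact: gc].
split=> [x Ux|i]; first by apply: continuousD; [exact: fc|exact: gc].
have [f1 f2] := fd i; have [g1 g2] := gd i; split=> [x Ux|].
  by apply: derivableD; [exact: f1|exact: g1].
apply: eq_Ck (IH _ _ f2 g2) => // x Ux.
by rewrite deriveD //; [exact: f1|exact: g1].
Qed.

Lemma CkM k U f g : open U -> Ck k U f -> Ck k U g -> Ck k U (f * g).
Proof.
move=> oU; elim: k f g => [|k IH] f g Ckf Ckg.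
  case: Ckf Ckg => [fc _] [gc _].
  by split=> // x Ux; apply: continuousM; [exact: fc|exact: gc].
have [fc fd] := Ckf; have [gc gd] := Ckg.
split=> [x Ux|i]; first by apply: continuousM; [exact: fc|exact: gc].
have [f1 f2] := fd i; have [g1 g2] := gd i; split=> [x Ux|].
  by apply: derivableM; [exact: f1|exact: g1].
apply: eq_Ck (CkD oU (IH _ _ (CkW Ckf) g2) (IH _ _ (CkW Ckg) f2)) => // x Ux.
by rewrite deriveM //; [exact: f1|exact: g1].
Qed.

Lemma smooth_on_cst U c : open U -> smooth_on U (cst c).
Proof. by move=> oU k; exact: Ck_cst. Qed.
Lemma smooth_onD U f g : open U ->
  smooth_on U f -> smooth_on U g -> smooth_on U (f + g).
Proof. by move=> oU sf sg k; apply: CkD. Qed.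
Lemma smooth_onM U f g : open U ->
  smooth_on U f -> smooth_on U g -> smooth_on U (f * g).
Proof. by move=> oU sf sg k; apply: CkM. Qed.
Lemma smooth_onN U f : open U -> smooth_on U f -> smooth_on U (- f).
Proof.
move=> oU sf; rewrite (_ : - f = cst (-1) * f); last first.
  by apply/funext => x; rewrite !fctE mulN1r.
by apply: smooth_onM => //; exact: smooth_on_cst.
Qed.

End Smoothness.

Record chart (R : realType) (M : topologicalType) (n : nat) := Chart {
  chart_dom : set M;
  chart_fwd : M -> 'rV[R]_n;
  chart_bwd : 'rV[R]_n -> M;
  chart_open_dom : open chart_dom;
  chart_open_img : open (chart_fwd @` chart_dom);
  chart_fwdK : forall x, chart_dom x -> chart_bwd (chart_fwd x) = x;
  chart_fwd_cont : {within chart_dom, continuous chart_fwd};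
  chart_bwd_cont : {within chart_fwd @` chart_dom, continuous chart_bwd} }.

Arguments chart_open_img {R M n} c.

Definition chart_compatible (R : realType) (M : topologicalType) (n : nat)
    (c c' : chart R M n) : Prop :=
  forall j : 'I_n,
    smooth_on (chart_fwd c @` (chart_dom c `&` chart_dom c'))
              (fun u => chart_fwd c' (chart_bwd c u) 0 j).

(* Without boundary, pure-dimensional, not assumed connected; the atlas need
   not be maximal. *)
Record smooth_manifold (R : realType) := SmoothManifold {
  mf_space :> topologicalType;
  mf_dim : nat;
  mf_atlas : set (chart R mf_space mf_dim);
  mf_hausdorff : hausdorff_space mf_space;
  mf_second_countable : @second_countable mf_space;
  mf_cover : forall x : mf_space, exists2 c, mf_atlas c & chart_dom c x;
  mf_compatible : forall c c', mf_atlas c -> mf_atlas c' ->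
    chart_compatible c c' }.

Section SmoothFunctions.
Variables (R : realType) (M : smooth_manifold R).
Local Notation C := R[i].

Definition smooth (f : M -> C) : Prop :=
  forall c, mf_atlas c ->
    smooth_on (chart_fwd c @` chart_dom c)
              (fun u => complex.Re (f (chart_bwd c u))) /\
    smooth_on (chart_fwd c @` chart_dom c)
              (fun u => complex.Im (f (chart_bwd c u))).

Definition smooth_pred : {pred M -> C} := [pred f | `[< smooth f >]].

Lemma smoothP f : reflect (smooth f) (f \in smooth_pred).
Proof. exact: asboolP. Qed.

Lemma smooth_cst (a : C) : smooth (cst a).
Proof.
by move=> c _; split; apply: smooth_on_cst; exact: chart_open_img.
Qed.

Lemma smoothD f g : smooth f -> smooth g -> smooth (f + g).
Proof.
move=> sf sg c Ac; have [f1 f2] := sf c Ac; have [g1 g2] := sg c Ac.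
have oU := chart_open_img c; split.
  rewrite (_ : (fun _ => _) = (fun u => complex.Re (f (chart_bwd c u))) +
    (fun u => complex.Re (g (chart_bwd c u)))); first exact: smooth_onD.
  by apply/funext => u /=; rewrite raddfD.
rewrite (_ : (fun _ => _) = (fun u => complex.Im (f (chart_bwd c u))) +
  (fun u => complex.Im (g (chart_bwd c u)))); first exact: smooth_onD.
by apply/funext => u /=; rewrite raddfD.
Qed.

Lemma smoothM f g : smooth f -> smooth g -> smooth (f * g).
Proof.
move=> sf sg c Ac; have [f1 f2] := sf c Ac; have [g1 g2] := sg c Ac.
have oU := chart_open_img c; split.
  rewrite (_ : (fun _ => _) =
     (fun u => complex.Re (f (chart_bwd c u))) *
     (fun u => complex.Re (g (chart_bwd c u))) +
   - ((fun u => complex.Im (f (chart_bwd c u))) *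
     (fun u => complex.Im (g (chart_bwd c u))))).
    by apply: smooth_onD => //; [|apply: smooth_onN => //]; exact: smooth_onM.
  apply/funext => u /=.
  by rewrite !fctE /=; case: (f _) => a b; case: (g _).
rewrite (_ : (fun _ => _) =
   (fun u => complex.Re (f (chart_bwd c u))) *
   (fun u => complex.Im (g (chart_bwd c u))) +
   (fun u => complex.Im (f (chart_bwd c u))) *
   (fun u => complex.Re (g (chart_bwd c u)))).
  by apply: smooth_onD => //; exact: smooth_onM.
apply/funext => u /=.
by rewrite !fctE /=; case: (f _) => a b; case: (g _).
Qed.

Lemma smooth_conj f : smooth f -> smooth (fun x => (f x)^*%C).
Proof.
move=> sf c Ac; have [f1 f2] := sf c Ac; have oU := chart_open_img c; split.
  rewrite (_ : (fun _ => _) = (fun u => complex.Re (f (chart_bwd c u)))) //.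
  by apply/funext => u /=; case: (f _).
rewrite (_ : (fun _ => _) = - (fun u => complex.Im (f (chart_bwd c u)))).
  exact: smooth_onN.
by apply/funext => u /=; rewrite !fctE /=; case: (f _).
Qed.

Record smooth_fun := SmoothFun {
  smooth_val :> M -> C;
  smooth_valP : smooth_val \in smooth_pred }.

HB.instance Definition _ := [isSub for smooth_val].
HB.instance Definition _ := [Choice of smooth_fun by <:].

Fact smooth_subring_closed : subring_closed smooth_pred.
Proof.
have smN f : smooth f -> smooth (- f).
  move=> sf; rewrite (_ : - f = cst (-1) * f).
    by apply: smoothM => //; exact: smooth_cst.
  by apply/funext => x; rewrite !fctE mulN1r.
split=> [|f g /smoothP sf /smoothP sg|f g /smoothP sf /smoothP sg]; apply/smoothP.
- exact: smooth_cst.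
- by apply: smoothD => //; exact: smN.
- exact: smoothM.
Qed.

HB.instance Definition _ :=
  GRing.isSubringClosed.Build _ smooth_pred smooth_subring_closed.
HB.instance Definition _ :=
  GRing.SubChoice_isSubComPzRing.Build _ _ smooth_fun smooth_subring_closed.

Definition smooth_const (a : C) : smooth_fun :=
  SmoothFun (introT (smoothP _) (smooth_cst a)).

Lemma smooth_const_zmod : zmod_morphism smooth_const.
Proof. by move=> a b; apply: val_inj; apply/funext. Qed.
Lemma smooth_const_monoid : monoid_morphism smooth_const.
Proof. by split=> [|a b]; apply: val_inj; apply/funext. Qed.
HB.instance Definition _ :=
  GRing.isZmodMorphism.Build C smooth_fun smooth_const smooth_const_zmod.
HB.instance Definition _ :=
  GRing.isMonoidMorphism.Build C smooth_fun smooth_const smooth_const_monoid.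

Definition smooth_conjf (f : smooth_fun) : smooth_fun :=
  SmoothFun (introT (smoothP _) (smooth_conj (elimT (smoothP _) (smooth_valP f)))).

End SmoothFunctions.

Section FunModule.
Variables (R : realType) (M : smooth_manifold R).
Local Notation F := (smooth_fun M).

Definition fscale (a : R[i]) (f : F) : F := smooth_const M a * f.

Fact fscaleA a b f : fscale a (fscale b f) = fscale (a * b) f.
Proof. by rewrite /fscale mulrA rmorphM. Qed.
Fact fscale1 : left_id 1 fscale.
Proof. by move=> f; rewrite /fscale rmorph1 mul1r. Qed.
Fact fscaleDr : right_distributive fscale +%R.
Proof. by move=> a f g; rewrite /fscale mulrDr. Qed.
Fact fscaleDl f : {morph fscale^~ f : a b / a + b}.
Proof. by move=> a b; rewrite /fscale rmorphD mulrDl. Qed.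
HB.instance Definition _ := GRing.Zmodule_isLmodule.Build R[i] F
  fscaleA fscale1 fscaleDr fscaleDl.

Lemma fscaleE a (f : F) : a *: f = smooth_const M a * f.
Proof. by []. Qed.

End FunModule.

Section VectorFields.
Variables (R : realType) (M : smooth_manifold R).
Local Notation F := (smooth_fun M).
Local Notation C := R[i].

Definition derivation (D : F -> F) : Prop :=
  (forall (a : C) f g, D (a *: f + g) = a *: D f + D g) /\
  (forall f g, D (f * g) = D f * g + f * D g).

Definition derivation_pred : {pred F -> F} := [pred D | `[< derivation D >]].

Lemma derivationP D : reflect (derivation D) (D \in derivation_pred).
Proof. exact: asboolP. Qed.

(* Complex vector fields, i.e. sections of TM (x) C, as C-linear derivations
   of C^oo(M, C). *)
Record vfield := VField {
  vf_val :> F -> F;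
  vf_valP : vf_val \in derivation_pred }.

HB.instance Definition _ := [isSub for vf_val].
HB.instance Definition _ := [Choice of vfield by <:].

Fact derivation_zmod_closed : zmod_closed derivation_pred.
Proof.
split=> [|D E /derivationP[D1 D2] /derivationP[E1 E2]]; apply/derivationP.
  by split=> [a f g|f g] /=; rewrite ?scaler0 ?mul0r ?mulr0 addr0.
split=> [a f g|f g]; rewrite !fctE.
  by rewrite D1 E1 !fscaleE; ring.
by rewrite D2 E2; ring.
Qed.

HB.instance Definition _ :=
  GRing.SubChoice_isSubZmodule.Build _ _ vfield derivation_zmod_closed.

Fact vscale_subproof (f : F) (X : vfield) :
  (fun g => f * X g) \in derivation_pred.
Proof.
have /derivationP[X1 X2] := vf_valP X; apply/derivationP.
by split=> [a g h|g h]; rewrite ?X1 ?X2 ?fscaleE; ring.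
Qed.
Definition vscale f X := VField (vscale_subproof f X).

Fact vscaleA f g X : vscale f (vscale g X) = vscale (f * g) X.
Proof. by apply: val_inj; apply/funext => h /=; rewrite mulrA. Qed.
Fact vscale1 : left_id 1 vscale.
Proof. by move=> X; apply: val_inj; apply/funext => h /=; rewrite mul1r. Qed.
Fact vscaleDr : right_distributive vscale +%R.
Proof. by move=> f X Y; apply: val_inj; apply/funext => h /=; rewrite !fctE mulrDr. Qed.
Fact vscaleDl X : {morph vscale^~ X : f g / f + g}.
Proof. by move=> f g; apply: val_inj; apply/funext => h /=; rewrite !fctE mulrDl. Qed.
HB.instance Definition _ := GRing.Zmodule_isLmodule.Build F vfield
  vscaleA vscale1 vscaleDr vscaleDl.

Fact lie_bracket_subproof (X Y : vfield) :
  (fun f => X (Y f) - Y (X f)) \in derivation_pred.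
Proof.
have /derivationP[X1 X2] := vf_valP X; have /derivationP[Y1 Y2] := vf_valP Y.
have XD f g : X (f + g) = X f + X g by have := X1 1 f g; rewrite !scale1r.
have YD f g : Y (f + g) = Y f + Y g by have := Y1 1 f g; rewrite !scale1r.
apply/derivationP; split=> [a f g|f g].
  by rewrite Y1 X1 X1 Y1 !fscaleE; ring.
by rewrite Y2 X2 XD YD !X2 !Y2; ring.
Qed.
Definition lie_bracket X Y := VField (lie_bracket_subproof X Y).

(* x comes from a section of TM: it commutes with complex conjugation. *)
Definition vf_real (X : vfield) : Prop :=
  forall f, X (smooth_conjf f) = smooth_conjf (X f).

End VectorFields.

Notation cochain M := (seq (vfield M) -> smooth_fun M).

Section Forms.
Variables (R : realType) (M : smooth_manifold R).
Local Notation F := (smooth_fun M).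
Local Notation X := (vfield M).
Local Notation T := (cochain M).

(* A complex k-form is an alternating C^oo(M, C)-multilinear map on k-tuples
   of complex vector fields. A cochain takes tuples of all lengths, and a
   k-form is extended by 0 to the lengths other than k. *)
Record is_form (k : nat) (a : T) : Prop := IsForm {
  form_size : forall s, size s <> k -> a s = 0;
  form_linear : forall s1 s2 (f : F) (x y : X),
    a (s1 ++ (f *: x + y) :: s2) = f * a (s1 ++ x :: s2) + a (s1 ++ y :: s2);
  form_alt : forall s1 s2 s3 (x : X), a (s1 ++ x :: s2 ++ x :: s3) = 0 }.

Definition cochain_one : T := fun s => if s is [::] then 1 else 0.

Fixpoint inversions (m : bitseq) : nat :=
  if m is b :: m' then ((if b then 0 else count id m') + inversions m')%N else 0.

(* Sum over shuffles, m marking the arguments given to a; there is no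
   factorial normalization, so dx /\ dy evaluates to 1 on (d_x, d_y). *)
Definition wedge (a b : T) : T := fun s =>
  \sum_(m : (size s).-tuple bool)
     (-1) ^+ inversions m * (a (mask m s) * b (mask (map negb m) s)).

Definition del (i : nat) (s : seq X) : seq X := take i s ++ drop i.+1 s.

(* Koszul's invariant formula for the exterior derivative:
   da(X_0..X_k) = sum_i (-1)^i X_i a(..^X_i..)
     + sum_(i<j) (-1)^(i+j) a([X_i,X_j],..^X_i..^X_j..). *)
Definition extd (a : T) : T := fun s =>
  \sum_(i < size s) (-1) ^+ i * s`_i (a (del i s)) +
  \sum_(j < size s) \sum_(i < j)
     (-1) ^+ (i + j) * a (lie_bracket s`_i s`_j :: del i (del j s)).

Lemma vfD (x : X) f g : x (f + g) = x f + x g.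
Proof.
have /derivationP[x1 _] := vf_valP x.
by have := x1 1 f g; rewrite !scale1r.
Qed.
Lemma vf0 (x : X) : x 0 = 0.
Proof. by apply: (addrI (x 0)); rewrite -vfD !addr0. Qed.
Lemma vfN (x : X) f : x (- f) = - x f.
Proof. by apply: (addrI (x f)); rewrite -vfD !subrr vf0. Qed.
Lemma vfM (x : X) f g : x (f * g) = x f * g + f * x g.
Proof. by have /derivationP[_ x2] := vf_valP x. Qed.
Lemma vfZ (x : X) (c : R[i]) f : x (c *: f) = c *: x f.
Proof.
have /derivationP[x1 _] := vf_valP x.
by have := x1 c f 0; rewrite vf0 !addr0.
Qed.
Lemma vf_sign (x : X) n f : x ((-1) ^+ n * f) = (-1) ^+ n * x f.
Proof.
by rewrite -signr_odd; case: (odd n); rewrite ?expr1 ?expr0 ?mul1r ?mulN1r ?vfN.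
Qed.
Lemma vf_const (x : X) c : x (smooth_const M c) = 0.
Proof.
have x1 : x 1 = 0.
  by apply: (addrI (x 1)); rewrite addr0 -{3}(mulr1 1) vfM mulr1 mul1r.
by rewrite -[smooth_const _ _]mulr1 -fscaleE vfZ x1 scaler0.
Qed.

Lemma vfAE (x y : X) (f : F) : (x + y) f = x f + y f. Proof. by []. Qed.
Lemma vfNE (x : X) (f : F) : (- x) f = - x f. Proof. by []. Qed.
Lemma vfSE g (x : X) (f : F) : (g *: x) f = g * x f. Proof. by []. Qed.
Lemma vf0E (f : F) : (0 : X) f = 0. Proof. by []. Qed.
Lemma brE (x y : X) (f : F) : lie_bracket x y f = x (y f) - y (x f). Proof. by []. Qed.
Definition vfE := (vfAE, vfNE, vfSE, vf0E, brE).

Lemma vf_ext (x y : X) : (forall f, x f = y f) -> x = y.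
Proof. by move=> e; apply: val_inj; apply/funext. Qed.

Local Notation br := lie_bracket.
Implicit Types (x y z w : X) (f g : F) (a b c : T) (s t : seq X).

Lemma brxx x : br x x = 0.
Proof. by apply: vf_ext => f; rewrite !vfE subrr. Qed.
Lemma brDl f x y z : (br (f *: x + y) z) = f *: (br x z) - z f *: x + (br y z).
Proof. by apply: vf_ext => g; rewrite !vfE vfD vfM; ring. Qed.
Lemma brDr f x y z : (br z (f *: x + y)) = f *: (br z x) + z f *: x + (br z y).
Proof. by apply: vf_ext => g; rewrite !vfE vfD vfM; ring. Qed.
Lemma jacobi x y z :
  (br x (br y z)) = (br (br x y) z) + (br y (br x z)).
Proof.
by apply: vf_ext => g; rewrite !vfE !(vfD, vfN); ring.
Qed.

Definition ins (x : X) (a : T) : T := fun t => a (x :: t).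
Definition sgn (a : T) : T := fun t => (-1) ^+ size t * a t.

Fixpoint wedger (s : seq X) (a b : T) : F :=
  if s is x :: s' then wedger s' (ins x a) b + wedger s' (sgn a) (ins x b)
  else a [::] * b [::].

Fixpoint lier (x : X) (s : seq X) (a : T) : F :=
  if s is y :: s' then lier x s' (ins y a) - a (br x y :: s')
  else x (a [::]).
Definition lie x (a : T) : T := fun s => lier x s a.

Fixpoint rdr (s : seq X) (a : T) : F :=
  if s is x :: s' then lie x a s' - rdr s' (ins x a) else 0.
Definition rd (a : T) : T := fun s => rdr s a.

Lemma sum_tuple_cons n (G : bitseq -> F) :
  \sum_(m : n.+1.-tuple bool) G m =
  \sum_(m : n.-tuple bool) G (true :: m) + \sum_(m : n.-tuple bool) G (false :: m).
Proof.
rewrite (reindex (fun p : bool * n.-tuple bool => [tuple of p.1 :: p.2])) /=.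
  rewrite -(pair_big xpredT xpredT (fun (b : bool) (m : n.-tuple bool) => G (b :: m))) /=.
  by rewrite big_bool.
exists (fun t : n.+1.-tuple bool => (thead t, [tuple of behead t])).
  by move=> [b m] _; congr (_, _); apply: val_inj.
by move=> t _; rewrite [RHS]tuple_eta; apply: val_inj.
Qed.

Lemma wedgeE a b s : wedge a b s = wedger s a b.
Proof.
elim: s a b => [|x s IH] a b.
  rewrite /wedge /= (bigD1 [tuple]) //= big1 ?addr0 ?mul1r // => m.
  by rewrite (tuple0 m) => /eqP.
rewrite /wedge /= (sum_tuple_cons _ (fun m : bitseq => (-1) ^+ inversions m *
  (a (mask m (x :: s)) * b (mask (map negb m) (x :: s))))) /=.
rewrite -!IH /wedge; congr (_ + _); apply: eq_bigr => m _.
rewrite /sgn /ins size_mask ?size_tuple // exprD; ring.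
Qed.

Lemma wedgeD1 a a' b s : wedger s (a + a') b = wedger s a b + wedger s a' b.
Proof.
elim: s a a' b => [|x s IH] a a' b /=; first by rewrite fctE mulrDl.
rewrite (_ : ins x (a + a') = ins x a + ins x a') //.
rewrite (_ : sgn (a + a') = sgn a + sgn a').
  by rewrite !IH; ring.
by apply/funext => t; rewrite /sgn !fctE mulrDr.
Qed.
Lemma wedgeD2 a b b' s : wedger s a (b + b') = wedger s a b + wedger s a b'.
Proof.
elim: s a b b' => [|x s IH] a b b' /=; first by rewrite fctE mulrDr.
by rewrite (_ : ins x (b + b') = ins x b + ins x b') // !IH; ring.
Qed.

Definition cmul (f : F) (a : T) : T := fun s => f * a s.

Lemma wedgeZ1 f a b s : wedger s (cmul f a) b = f * wedger s a b.
Proof.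
elim: s a b => [|x s IH] a b /=; first by rewrite /cmul mulrA.
rewrite (_ : ins x (cmul f a) = cmul f (ins x a)) //.
rewrite (_ : sgn (cmul f a) = cmul f (sgn a)); first by rewrite !IH mulrDr.
by apply/funext => t; rewrite /sgn /cmul; ring.
Qed.
Lemma wedgeZ2 f a b s : wedger s a (cmul f b) = f * wedger s a b.
Proof.
elim: s a b => [|x s IH] a b /=; first by rewrite /cmul; ring.
by rewrite (_ : ins x (cmul f b) = cmul f (ins x b)) // !IH mulrDr.
Qed.

Lemma cmulE (c : R[i]) (a : T) : c *: a = cmul (smooth_const M c) a.
Proof. by []. Qed.
Lemma cmulN1 (a : T) : - a = cmul (-1) a.
Proof. by apply/funext => s; rewrite /cmul mulN1r. Qed.

Lemma wedgeN1 a b s : wedger s (- a) b = - wedger s a b.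
Proof. by rewrite cmulN1 wedgeZ1 mulN1r. Qed.
Lemma wedgeN2 a b s : wedger s a (- b) = - wedger s a b.
Proof. by rewrite cmulN1 wedgeZ2 mulN1r. Qed.
Lemma wedge01 b s : wedger s 0 b = 0.
Proof. by have := wedgeD1 0 0 b s; rewrite addr0 => /eqP; rewrite -subr_eq0 opprD addNKr oppr_eq0 => /eqP. Qed.
Lemma wedge02 a s : wedger s a 0 = 0.
Proof. by have := wedgeD2 a 0 0 s; rewrite addr0 => /eqP; rewrite -subr_eq0 opprD addNKr oppr_eq0 => /eqP. Qed.

Lemma sgnK a : sgn (sgn a) = a.
Proof.
by apply/funext => t; rewrite /sgn mulrA -exprD addnn -signr_odd odd_double mul1r.
Qed.
Lemma ins_sgn x a : ins x (sgn a) = - sgn (ins x a).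
Proof. by apply/funext => t; rewrite /ins /sgn !fctE /= exprS mulN1r mulNr. Qed.

Lemma ins_wedge x a b : ins x (wedge a b) = wedge (ins x a) b + wedge (sgn a) (ins x b).
Proof. by apply/funext => s; rewrite /ins wedgeE /= !fctE !wedgeE. Qed.

Lemma wedge_sgn s a b : wedger s (sgn a) (sgn b) = (-1) ^+ size s * wedger s a b.
Proof.
elim: s a b => [|x s IH] a b /=; first by rewrite /sgn /= !expr0 !mul1r.
by rewrite !ins_sgn wedgeN1 wedgeN2 !IH exprS; ring.
Qed.

Lemma sgn_wedge a b : sgn (wedge a b) = wedge (sgn a) (sgn b).
Proof. by apply/funext => s; rewrite wedgeE wedge_sgn /sgn wedgeE. Qed.

Lemma wedgeA a b c : wedge (wedge a b) c = wedge a (wedge b c).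
Proof.
apply/funext => s; rewrite !wedgeE; elim: s a b c => [|x s IH] a b c /=.
  by rewrite !wedgeE /= mulrA.
rewrite !ins_wedge sgn_wedge wedgeD1 wedgeD2 !IH; ring.
Qed.

Lemma wedge_onel a : wedge cochain_one a = a.
Proof.
have H0 b s : wedger s (fun _ => 0) b = 0 := wedge01 b s.
have H s : forall b, wedger s cochain_one b = b s.
  elim: s => [|x s IH] b /=; first by rewrite mul1r.
  rewrite (_ : ins x _ = fun _ => 0) // H0 add0r.
  rewrite (_ : sgn cochain_one = cochain_one) ?IH //.
  by apply/funext => -[|y t]; rewrite /sgn /= ?mulr0 ?mulr1.
by apply/funext => s; rewrite wedgeE H.
Qed.
Lemma wedge_oner a : wedge a cochain_one = a.
Proof.
have H0 b s : wedger s b (fun _ => 0) = 0 := wedge02 b s.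
have H s : forall b, wedger s b cochain_one = b s.
  elim: s => [|x s IH] b /=; first by rewrite mulr1.
  by rewrite (_ : ins x cochain_one = fun _ => 0) // H0 addr0 IH.
by apply/funext => s; rewrite wedgeE H.
Qed.

Lemma lierD x s a b : lier x s (a + b) = lier x s a + lier x s b.
Proof.
elim: s a b => [|y s IH] a b /=; first by rewrite fctE vfD.
by rewrite (_ : ins y (a + b) = ins y a + ins y b) // IH fctE; ring.
Qed.
Lemma lierZ x s f a : lier x s (cmul f a) = f * lier x s a + x f * a s.
Proof.
elim: s a => [|y s IH] a /=; first by rewrite vfM; ring.
by rewrite (_ : ins y (cmul f a) = cmul f (ins y a)) // IH /cmul /ins; ring.
Qed.
Lemma vfN1 (x : X) : x (-1) = 0.
Proof. by rewrite -(rmorphN1 (smooth_const M)) vf_const. Qed.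
Lemma lierN x s a : lier x s (- a) = - lier x s a.
Proof. by rewrite cmulN1 lierZ vfN1; ring. Qed.
Lemma lierB x s a b : lier x s (a - b) = lier x s a - lier x s b.
Proof. by rewrite lierD lierN. Qed.

Lemma ins_lie x y a : ins y (lie x a) = lie x (ins y a) - ins (br x y) a.
Proof. by apply/funext. Qed.

Lemma rdrD s a b : rdr s (a + b) = rdr s a + rdr s b.
Proof.
elim: s a b => [|x s IH] a b /=; first by rewrite addr0.
by rewrite /lie lierD (_ : ins x (a + b) = ins x a + ins x b) // IH; ring.
Qed.
Lemma rdrN s a : rdr s (- a) = - rdr s a.
Proof.
elim: s a => [|x s IH] a /=; first by rewrite oppr0.
by rewrite /lie lierN (_ : ins x (- a) = - ins x a) // IH; ring.
Qed.
Lemma rdrB s a b : rdr s (a - b) = rdr s a - rdr s b.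
Proof. by rewrite rdrD rdrN. Qed.
Lemma ins_rd x a : ins x (rd a) = lie x a - rd (ins x a).
Proof. by apply/funext. Qed.

Lemma lie_sgn x s a : lier x s (sgn a) = (-1) ^+ size s * lier x s a.
Proof.
elim: s a => [|y s IH] a /=; first by rewrite /sgn /= !expr0 !mul1r.
by rewrite ins_sgn lierN IH /sgn /= exprS; ring.
Qed.
Lemma sgn_lie x a : sgn (lie x a) = lie x (sgn a).
Proof. by apply/funext => s; rewrite /lie lie_sgn. Qed.
Lemma rd_sgn s a : rdr s (sgn a) = - ((-1) ^+ size s * rdr s a).
Proof.
elim: s a => [|x s IH] a /=; first by rewrite mulr0 oppr0.
by rewrite ins_sgn rdrN IH /lie lie_sgn exprS; ring.
Qed.
Lemma sgn_rd a : rd (sgn a) = - sgn (rd a).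
Proof. by apply/funext => s; rewrite /rd rd_sgn. Qed.

Lemma lie_wedge x s a b :
  lier x s (wedge a b) = wedger s (lie x a) b + wedger s a (lie x b).
Proof.
elim: s a b => [|y s IH] a b /=; first by rewrite !wedgeE /= vfM.
rewrite ins_wedge lierD !IH ins_lie ins_lie sgn_lie wedgeE /=.
by rewrite !wedgeD1 !wedgeD2 wedgeN1 wedgeN2; ring.
Qed.

Lemma rd_wedge s a b :
  rdr s (wedge a b) = wedger s (rd a) b + wedger s (sgn a) (rd b).
Proof.
elim: s a b => [|x s IH] a b /=; first by rewrite /rd /= mul0r mulr0 addr0.
rewrite ins_wedge rdrD !IH /lie lie_wedge !ins_rd ins_sgn sgn_rd sgnK.
by rewrite !wedgeD1 !wedgeD2 !wedgeN1 wedgeN2; ring.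
Qed.

Definition multi (a : T) := forall s1 s2 (f : F) (x y : X),
  a (s1 ++ (f *: x + y) :: s2) = f * a (s1 ++ x :: s2) + a (s1 ++ y :: s2).
Definition alt1 (a : T) := forall s1 s2 (x : X), a (s1 ++ x :: x :: s2) = 0.

Lemma multi_ins x a : multi a -> multi (ins x a).
Proof. by move=> m s1 s2 f y z; apply: (m (x :: s1)). Qed.
Lemma alt1_ins x a : alt1 a -> alt1 (ins x a).
Proof. by move=> m s1 s2 y; apply: (m (x :: s1)). Qed.

Lemma multiD a s1 s2 x y : multi a ->
  a (s1 ++ (x + y) :: s2) = a (s1 ++ x :: s2) + a (s1 ++ y :: s2).
Proof. by move=> m; have := m s1 s2 1 x y; rewrite scale1r mul1r. Qed.
Lemma multi0 a s1 s2 : multi a -> a (s1 ++ 0 :: s2) = 0.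
Proof.
by move=> m; apply: (addrI (a (s1 ++ 0 :: s2))); rewrite -multiD // !addr0.
Qed.
Lemma multiZ a s1 s2 f x : multi a ->
  a (s1 ++ (f *: x) :: s2) = f * a (s1 ++ x :: s2).
Proof. by move=> m; have := m s1 s2 f x 0; rewrite multi0 // !addr0. Qed.
Lemma multiN a s1 s2 x : multi a -> a (s1 ++ (- x) :: s2) = - a (s1 ++ x :: s2).
Proof. by move=> m; rewrite -scaleN1r multiZ // mulN1r. Qed.

Lemma alt_swap a s1 s2 x y : multi a -> alt1 a ->
  a (s1 ++ x :: y :: s2) = - a (s1 ++ y :: x :: s2).
Proof.
move=> m l; have := l s1 s2 (x + y); rewrite multiD //.
have /= e1 := multiD (s1 ++ [:: x]) s2 x y m.
have /= e2 := multiD (s1 ++ [:: y]) s2 x y m.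
rewrite -!catA /= in e1 e2.
by rewrite e1 e2 !l add0r addr0 => /eqP; rewrite addr_eq0 => /eqP.
Qed.

Lemma alt_move a s1 s2 s3 x : multi a -> alt1 a ->
  a (s1 ++ x :: s2 ++ s3) = (-1) ^+ size s2 * a (s1 ++ s2 ++ x :: s3).
Proof.
move=> m l; elim: s2 s1 => [|y s2 IH] s1 /=; first by rewrite mul1r.
rewrite alt_swap // -cat_rcons IH cat_rcons exprS; ring.
Qed.

Lemma alt1_alt a s1 s2 s3 x : multi a -> alt1 a ->
  a (s1 ++ x :: s2 ++ x :: s3) = 0.
Proof. by move=> m l; rewrite alt_move // catA l mulr0. Qed.

Lemma is_formP k a : is_form k a <->
  [/\ forall s, size s <> k -> a s = 0, multi a & alt1 a].
Proof.
split=> [[h1 h2 h3]|[h1 h2 h3]]; split=> //.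
  by move=> s1 s2 x; apply: (h3 s1 [::]).
by move=> *; apply: alt1_alt.
Qed.

Lemma ins_multi a f x y : multi a ->
  ins (f *: x + y) a = cmul f (ins x a) + ins y a.
Proof. by move=> m; apply/funext => t; exact: (m [::]). Qed.

Lemma multi_sgn a : multi a -> multi (sgn a).
Proof. by move=> m s1 s2 f x y; rewrite /sgn m !size_cat /=; ring. Qed.
Lemma alt1_sgn a : alt1 a -> alt1 (sgn a).
Proof. by move=> m s1 s2 x; rewrite /sgn m mulr0. Qed.

Lemma wedge_multi a b : multi a -> multi b -> multi (wedge a b).
Proof.
move=> ma mb s1; elim: s1 a b ma mb => [|z s1 IH] a b ma mb s2 f x y.
  rewrite !wedgeE /= !ins_multi // wedgeD1 wedgeD2 wedgeZ1 wedgeZ2; ring.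
have h s : wedge a b (z :: s) = (wedge (ins z a) b + wedge (sgn a) (ins z b)) s.
  by rewrite -ins_wedge.
by rewrite !cat_cons !h !fctE IH ?IH //; do ?[exact: multi_ins|exact: multi_sgn|ring].
Qed.

Lemma wedge_alt1 a b : alt1 a -> alt1 b -> alt1 (wedge a b).
Proof.
move=> ma mb s1; elim: s1 a b ma mb => [|z s1 IH] a b ma mb s2 x.
  rewrite wedgeE /= !ins_sgn !sgnK wedgeN1.
  have h (c : T) : alt1 c -> ins x (ins x c) = 0.
    by move=> l; apply/funext => t; exact: (l [::]).
  by rewrite !h // wedge01 wedge02; ring.
have h s : wedge a b (z :: s) = (wedge (ins z a) b + wedge (sgn a) (ins z b)) s.
  by rewrite -ins_wedge.
by rewrite !cat_cons !h !fctE !IH ?addr0 //; do ?[exact: alt1_ins|exact: alt1_sgn].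
Qed.

Lemma wedge_size p q (a b : T) : (forall s, size s <> p -> a s = 0) ->
  (forall s, size s <> q -> b s = 0) ->
  forall s, size s <> (p + q)%N -> wedge a b s = 0.
Proof.
move=> ha hb s hs; rewrite /wedge big1 // => m _.
have [ep|/eqP np] := eqVneq (size (mask m s)) p; last by rewrite ha // mul0r mulr0.
rewrite [b _]hb ?mulr0 // => eq; apply: hs.
rewrite -ep -eq !size_mask ?size_map ?size_tuple // count_map.
by rewrite -[LHS](size_tuple m) -(count_predC id).
Qed.

Lemma wedge_form p q a b : is_form p a -> is_form q b -> is_form (p + q) (wedge a b).
Proof.
move=> /is_formP[a1 a2 a3] /is_formP[b1 b2 b3]; apply/is_formP; split.
- exact: wedge_size.
- exact: wedge_multi.
- exact: wedge_alt1.
Qed.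

Lemma lie_multi x a : multi a -> multi (lie x a).
Proof.
move=> m s1; elim: s1 a m => [|z s1 IH] a m s2 f y w; rewrite /lie /=.
  rewrite ins_multi // lierD lierZ brDr.
  have e u v : a ((u + v) :: s2) = a (u :: s2) + a (v :: s2) by exact: (multiD [::]).
  have eZ g u : a ((g *: u) :: s2) = g * a (u :: s2) by exact: (multiZ [::]).
  by rewrite !e !eZ /ins; ring.
have := IH _ (multi_ins z m) s2 f y w; rewrite /lie => ->.
by rewrite -!cat_cons m; ring.
Qed.

Lemma lie_alt1 x a : multi a -> alt1 a -> alt1 (lie x a).
Proof.
move=> m l s1; elim: s1 a m l => [|z s1 IH] a m l s2 y; rewrite /lie /=.
  rewrite (_ : ins y (ins y a) = 0); last by apply/funext => t; exact: (l [::]).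
  have z0 : lier x s2 0 = 0 by have := lierD x s2 0 0; rewrite addr0 => /eqP;
    rewrite -subr_eq0 opprD addNKr oppr_eq0 => /eqP.
  rewrite z0 /ins (alt_swap [::] s2 y (br x y)) //=; ring.
have := IH _ (multi_ins z m) (alt1_ins z l) s2 y; rewrite /lie => ->.
by rewrite -!cat_cons l subr0.
Qed.

Fixpoint edf (f : F) (x : X) (s : seq X) (a : T) : F :=
  if s is y :: s' then y f * a (x :: s') + edf f x s' (ins y a) else 0.

Lemma lier_scale f x y s a : multi a ->
  lier (f *: x + y) s a = f * lier x s a + edf f x s a + lier y s a.
Proof.
elim: s a => [|z s IH] a m /=; first by rewrite addr0.
rewrite IH; last exact: multi_ins.
rewrite brDl.
have e u v : a ((u + v) :: s) = a (u :: s) + a (v :: s) by exact: (multiD [::]).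
have eZ g u : a ((g *: u) :: s) = g * a (u :: s) by exact: (multiZ [::]).
have eN u : a ((- u) :: s) = - a (u :: s) by exact: (multiN [::]).
by rewrite !e eN !eZ; ring.
Qed.

Fixpoint dfw (f : F) (s : seq X) (a : T) : F :=
  if s is y :: s' then y f * a s' - dfw f s' (ins y a) else 0.

Lemma rdrZ f s a : rdr s (cmul f a) = f * rdr s a + dfw f s a.
Proof.
elim: s a => [|y s IH] a /=; first by ring.
by rewrite /lie lierZ (_ : ins y (cmul f a) = cmul f (ins y a)) // IH; ring.
Qed.

Lemma dfwN f s a : dfw f s (- a) = - dfw f s a.
Proof.
elim: s a => [|y s IH] a /=; first by rewrite oppr0.
by rewrite (_ : ins y (- a) = - ins y a) // IH fctE; ring.
Qed.

Lemma dfw_edf f x s a : multi a -> alt1 a -> dfw f s (ins x a) = edf f x s a.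
Proof.
elim: s a => [|y s IH] a m l //=.
rewrite (_ : ins y (ins x a) = - ins x (ins y a)); last first.
  by apply/funext => t; exact: (alt_swap [::]).
by rewrite dfwN IH ?opprK //; [exact: multi_ins|exact: alt1_ins].
Qed.

Lemma rd_multi a : multi a -> alt1 a -> multi (rd a).
Proof.
move=> m l s1; elim: s1 a m l => [|z s1 IH] a m l s2 f y w; rewrite /rd /=.
  by rewrite ins_multi // rdrD rdrZ dfw_edf // /lie lier_scale //; ring.
have := IH _ (multi_ins z m) (alt1_ins z l) s2 f y w; rewrite /rd => ->.
by rewrite lie_multi //; ring.
Qed.

Lemma rd_alt1 a : multi a -> alt1 a -> alt1 (rd a).
Proof.
move=> m l s1; elim: s1 a m l => [|z s1 IH] a m l s2 y; rewrite /rd /=.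
  rewrite (_ : ins y (ins y a) = 0); last by apply/funext => t; exact: (l [::]).
  have z0 : rdr s2 0 = 0 by have := rdrD s2 0 0; rewrite addr0 => /eqP;
    rewrite -subr_eq0 opprD addNKr oppr_eq0 => /eqP.
  by rewrite z0 /lie /= brxx (multi0 [::]) //; ring.
have := IH _ (multi_ins z m) (alt1_ins z l) s2 y; rewrite /rd => ->.
by rewrite lie_alt1 // subr0.
Qed.

Lemma lie_lie x y s a : multi a ->
  lier x s (lie y a) - lier y s (lie x a) = lier (br x y) s a.
Proof.
elim: s a => [|z s IH] a m //=.
rewrite !ins_lie !lierB -IH /lie /=; last exact: multi_ins.
have e u v : a ((u + v) :: s) = a (u :: s) + a (v :: s) by exact: (multiD [::]).
have eN u : a ((- u) :: s) = - a (u :: s) by exact: (multiN [::]).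
have -> : (br (br x y) z) = (br x (br y z)) - (br y (br x z)).
  by rewrite jacobi addrK.
by rewrite e eN; ring.
Qed.

Lemma rd_lie x s a : multi a -> rdr s (lie x a) = lier x s (rd a).
Proof.
elim: s a => [|y s IH] a m /=; first by rewrite /rd /= vf0.
rewrite ins_lie rdrB IH; last exact: multi_ins.
rewrite ins_rd lierB /=.
rewrite -[lie (br x y) a s]/(lier (br x y) s a) -lie_lie //.
by rewrite -[lie y (lie x a) s]/(lier y s (lie x a)) -[rd (ins _ _) _]/(rdr _ _); ring.
Qed.

Lemma rd_rd s a : multi a -> rdr s (rd a) = 0.
Proof.
elim: s a => [|x s IH] a m //=.
rewrite ins_rd rdrB rd_lie // IH; last exact: multi_ins.
by rewrite /lie; ring.
Qed.

Lemma lier_sum x s a : multi a -> alt1 a ->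
  lier x s a = x (a s) - \sum_(j < size s) (-1) ^+ j * a ((br x s`_j) :: del j s).
Proof.
elim: s a => [|y s IH] a m l /=; first by rewrite big_ord0 subr0.
rewrite IH; [|exact: multi_ins|exact: alt1_ins].
rewrite big_ord_recl /= /ins expr0 mul1r /del take0 drop1 /=.
rewrite -addrA; congr (_ + _); rewrite opprD addrC; congr (_ + _).
rewrite -sumrN -sumrN; apply: eq_bigr => j _.
by rewrite exprS (alt_swap [::]) //=; ring.
Qed.

Lemma del0 x s : del 0 (x :: s) = s.
Proof. by rewrite /del take0 /= drop0. Qed.
Lemma delS i x s : del i.+1 (x :: s) = x :: del i s.
Proof. by []. Qed.

Lemma extdE a : multi a -> alt1 a -> extd a = rd a.
Proof.
move=> m l; apply/funext => s; elim: s a m l => [|x s IH] a m l.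
  by rewrite /extd /rd /= !big_ord0 addr0.
have -> : rd a (x :: s) = lie x a s - extd (ins x a) s.
  by rewrite IH //; [exact: multi_ins|exact: alt1_ins].
rewrite /lie lier_sum // /extd [size (x :: s)]/= !big_ord_recl big_ord0 add0r.
rewrite expr0 mul1r del0 [nth _ _ _]/=.
have -> : \sum_(i < size s) (-1) ^+ lift ord0 i *
    (x :: s)`_(lift ord0 i) (a (del (lift ord0 i) (x :: s)))
  = - \sum_(i < size s) (-1) ^+ i * s`_i (ins x a (del i s)).
  rewrite -sumrN; apply: eq_bigr => i _.
  by rewrite lift0 delS exprS /=; ring.
set A := x (a s); set B := \sum_(i < size s) _.
have -> : \sum_(j < size s) \sum_(i < lift ord0 j) (-1) ^+ (i + lift ord0 j) *
    a (br (x :: s)`_i (x :: s)`_(lift ord0 j) ::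
       del i (del (lift ord0 j) (x :: s)))
  = - (\sum_(j < size s) (-1) ^+ j * a (br x s`_j :: del j s)) -
    \sum_(j < size s) \sum_(i < j)
      (-1) ^+ (i + j) * ins x a (br s`_i s`_j :: del i (del j s)).
  rewrite -!sumrN -big_split; apply: eq_bigr => j _.
  rewrite lift0 big_ord_recl delS del0 add0n exprS mulN1r mulNr.
  congr (_ + _); rewrite -sumrN; apply: eq_bigr => i _.
  rewrite lift0 delS addSn addnS !exprS (alt_swap [::]) // /ins /=; ring.
by rewrite /B; ring.
Qed.

End Forms.

Section DGA.
Variable C : fieldType.

(* Graded over nat, associative and unital. *)
Record dga := DGA {
  dga_sort :> nat -> lmodType C;
  dga_one : dga_sort 0;
  dga_mul : forall p q, dga_sort p -> dga_sort q -> dga_sort (p + q);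
  dga_diff : forall p, dga_sort p -> dga_sort p.+1;
  dga_mulPl : forall p q (c : C) (x y : dga_sort p) (z : dga_sort q),
    dga_mul (c *: x + y) z = c *: dga_mul x z + dga_mul y z;
  dga_mulPr : forall p q (c : C) (x : dga_sort p) (y z : dga_sort q),
    dga_mul x (c *: y + z) = c *: dga_mul x y + dga_mul x z;
  dga_mulA : forall p q r (x : dga_sort p) (y : dga_sort q) (z : dga_sort r),
    dga_mul (dga_mul x y) z =
    ecast n (dga_sort n) (addnA p q r) (dga_mul x (dga_mul y z));
  dga_mul1l : forall p (x : dga_sort p), dga_mul dga_one x = x;
  dga_mul1r : forall p (x : dga_sort p),
    dga_mul x dga_one = ecast n (dga_sort n) (esym (addn0 p)) x;
  dga_diffP : forall p (c : C) (x y : dga_sort p),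
    dga_diff (c *: x + y) = c *: dga_diff x + dga_diff y;
  dga_diffK : forall p (x : dga_sort p), dga_diff (dga_diff x) = 0;
  dga_leibniz : forall p q (x : dga_sort p) (y : dga_sort q),
    dga_diff (dga_mul x y) =
    dga_mul (dga_diff x) y +
    (-1) ^+ p *: ecast n (dga_sort n) (addnS p q) (dga_mul x (dga_diff y)) }.

Record dga_hom (A B : dga) := DGAHom {
  dga_map :> forall p, A p -> B p;
  dga_mapP : forall p (c : C) (x y : A p),
    dga_map (c *: x + y) = c *: dga_map x + dga_map y;
  dga_map1 : dga_map (dga_one A) = dga_one B;
  dga_mapM : forall p q (x : A p) (y : A q),
    dga_map (dga_mul x y) = dga_mul (dga_map x) (dga_map y);
  dga_map_diff : forall p (x : A p),
    dga_map (dga_diff x) = dga_diff (dga_map x) }.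

Definition cocycle (A : dga) p (x : A p) : Prop := dga_diff x = 0.

Definition coboundary (A : dga) p : A p -> Prop :=
  if p is q.+1 then fun x => exists y : A q, x = dga_diff y else fun x => x = 0.

(* Injectivity and surjectivity of the map induced on cocycles modulo
   coboundaries, spelled out on representatives. *)
Definition quasi_iso (A B : dga) (f : dga_hom A B) : Prop :=
  forall p,
    (forall x : A p, cocycle x -> coboundary (f p x) -> coboundary x) /\
    (forall y : B p, cocycle y ->
       exists2 x : A p, cocycle x & coboundary (f p x - y)).

Inductive dga_equiv : dga -> dga -> Prop :=
| dga_equiv_refl A : dga_equiv A A
| dga_equiv_fwd A B D (f : dga_hom A B) :
    quasi_iso f -> dga_equiv B D -> dga_equiv A D
| dga_equiv_bwd A B D (f : dga_hom B A) :
    quasi_iso f -> dga_equiv B D -> dga_equiv A D.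

Definition formal (A : dga) : Prop :=
  exists B : dga,
    (forall p (x : B p), dga_diff x = 0) /\ dga_equiv A B.

End DGA.

Section ComplexStructures.
Variables (R : realType) (M : smooth_manifold R).
Local Notation F := (smooth_fun M).
Local Notation X := (vfield M).
Local Notation iF := (smooth_const M 'i%C).

Definition type10 (I : X -> X) (x : X) : Prop := I x = iF *: x.
Definition type01 (I : X -> X) (x : X) : Prop := I x = - iF *: x.

(* A real endomorphism of the tangent bundle is encoded by its C-linear
   extension; integrability is involutivity of the (1,0)-fields. *)
Record complex_structure (I : {linear X -> X}) : Prop := ComplexStructure {
  cs_real : forall x, vf_real x -> vf_real (I x);
  cs_square : forall x, I (I x) = - x;
  cs_integrable : forall x y,
    type10 I x -> type10 I y -> type10 I (lie_bracket x y) }.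

Record hypercomplex := Hypercomplex {
  hcI : {linear X -> X};
  hcJ : {linear X -> X};
  hcK : {linear X -> X};
  hcI_complex : complex_structure hcI;
  hcJ_complex : complex_structure hcJ;
  hcK_complex : complex_structure hcK;
  hcIJ_anticomm : forall x, hcI (hcJ x) = - hcJ (hcI x);
  hcJK_anticomm : forall x, hcJ (hcK x) = - hcK (hcJ x);
  hcIK_anticomm : forall x, hcI (hcK x) = - hcK (hcI x);
  hcIJK : forall x, hcI (hcJ x) = hcK x }.

End ComplexStructures.

Section Dolbeault.
Variables (R : realType) (M : smooth_manifold R) (H : hypercomplex M).
Local Notation F := (smooth_fun M).
Local Notation X := (vfield M).
Local Notation T := (cochain M).
Local Notation I := (hcI H).
Local Notation J := (hcJ H).
Local Notation iF := (smooth_const M 'i%C).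
Local Notation halfF := (smooth_const M 2^-1).

Definition proj10 (x : X) : X := halfF *: (x - iF *: I x).
Definition proj01 (x : X) : X := halfF *: (x + iF *: I x).

(* a is a form of bidegree (p, q): a (p + q)-form vanishing on all tuples of
   fields of pure type, unless exactly p of them are (1,0) and q are (0,1) *)
Definition bidegree (p q : nat) (a : T) : Prop :=
  is_form (p + q) a /\
  forall u : seq (bool * X),
    (forall (b : bool) x, (b, x) \in u -> if b then type10 I x else type01 I x) ->
    (count id (unzip1 u), count negb (unzip1 u)) <> (p, q) ->
    a (unzip2 u) = 0.

(* On k-forms this is the projection onto the bidegree (p, k - p) part. *)
Definition proj_type (p : nat) (a : T) : T := fun s =>
  \sum_(m : (size s).-tuple bool | count id m == p)
     a [seq (if bx.1 then proj10 bx.2 else proj01 bx.2) | bx <- zip m s].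

(* The Dolbeault operators on forms of bidegree (p, q), for any q. *)
Definition dolb (p : nat) (a : T) : T := proj_type p.+1 (extd a).
Definition dolbbar (p : nat) (a : T) : T := proj_type p (extd a).

Definition act (L : X -> X) (a : T) : T := fun s => a (map L s).

(* J maps A^{p,0} to A^{0,p}, and J^-1 = -J on vector fields. *)
Definition dolbJ (a : T) : T := act (fun x => - J x) (dolbbar 0 (act J a)).

(* The images inside A^{p,0}(M), with A^{q,0}(M) = 0 for q < 0. *)
Definition Im_dolb (p : nat) : set T :=
  if p is q.+1 then dolb q @` [set b | bidegree q 0 b] else [set 0].

Definition Im_dolbJ (p : nat) : set T :=
  if p is q.+1 then dolbJ @` [set b | bidegree q 0 b] else [set 0].

Definition Im_dolb_dolbJ (p : nat) : set T :=
  if p is q.+2 then (dolb q.+1 \o dolbJ) @` [set b | bidegree q 0 b]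
  else [set 0].

Definition ddJ_lemma : Prop :=
  forall p : nat,
    Im_dolb p `&` [set a | dolbJ a = 0] = Im_dolb_dolbJ p /\
    Im_dolbJ p `&` [set a | dolb p a = 0] = Im_dolb_dolbJ p.

Implicit Types (x y : X) (a b : T) (s : seq X).

Definition kills01 (a : T) : Prop := forall s1 s2 x, type01 I x -> a (s1 ++ x :: s2) = 0.

Lemma half2 : halfF + halfF = 1.
Proof. by rewrite -rmorphD /= -[2^-1]mul1r -splitr rmorph1. Qed.

Lemma ii : iF * iF = -1.
Proof.
rewrite -rmorphM -(rmorphN1 (smooth_const M)); congr smooth_const.
by rewrite -expr2 sqr_i.
Qed.

Lemma proj_sum x : x = proj10 x + proj01 x.
Proof.
by rewrite /proj10 /proj01 -scalerDr addrACA addNr addr0 scalerDr -scalerDl half2 scale1r.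
Qed.

Lemma proj10_type x : type10 I (proj10 x).
Proof.
rewrite /type10 /proj10 linearZ /= linearB /= linearZ /= (cs_square (hcI_complex H)).
rewrite scalerN opprK !scalerA mulrC -scalerA; congr (_ *: _).
by rewrite scalerBr scalerA ii scaleN1r opprK addrC.
Qed.

Lemma proj01_type x : type01 I (proj01 x).
Proof.
rewrite /type01 /proj01 linearZ /= linearD /= linearZ /= (cs_square (hcI_complex H)).
rewrite !scalerA mulrC -scalerA; congr (_ *: _).
by rewrite scalerDr scalerA mulNr ii opprK scale1r scalerN scaleNr addrC.
Qed.

Lemma proj10_id x : type10 I x -> proj10 x = x.
Proof.
rewrite /type10 /proj10 => ->.
by rewrite scalerA ii scaleN1r opprK scalerDr -scalerDl half2 scale1r.
Qed.

Lemma bidegree_kills01 p a : bidegree p 0 a -> kills01 a.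
Proof.
case=> fa ha s1 s2 x tx; have [_ ma _] := (is_formP _ _).1 fa.
pose pure (u : seq (bool * X)) :=
  forall (b : bool) x, (b, x) \in u -> if b then type10 I x else type01 I x.
have base u v : pure u -> pure v -> a (unzip2 u ++ x :: unzip2 v) = 0.
  move=> pu pv; have := ha (u ++ (false, x) :: v).
  rewrite [unzip2 (_ ++ _)]map_cat /=; apply.
    by move=> b y; rewrite mem_cat inE => /or3P[/pu|/eqP[-> ->]|/pv].
  by rewrite [unzip1 _]map_cat !count_cat /= add1n addnS => -[].
have step2 t u v : pure u -> pure v -> a (unzip2 u ++ x :: unzip2 v ++ t) = 0.
  elim: t v => [|y t IH] v pu pv; first by rewrite cats0; exact: base.
  rewrite (proj_sum y) -cat_cons catA (multiD _ _ _ _ ma).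
  have ext (b : bool) z : (if b then type10 I z else type01 I z) -> pure (rcons v (b, z)).
    by move=> h b' z'; rewrite mem_rcons inE => /orP[/eqP[-> ->]|/pv].
  have e (b : bool) z : (if b then type10 I z else type01 I z) ->
      a ((unzip2 u ++ x :: unzip2 v) ++ z :: t) = 0.
    move=> h; have := IH (rcons v (b, z)) pu (ext _ _ h).
    by rewrite [unzip2 (rcons _ _)]map_rcons /= cat_rcons -cat_cons catA.
  by rewrite (e true) ?(e false) ?addr0; [|exact: proj01_type|exact: proj10_type].
have step1 t u : pure u -> a (unzip2 u ++ t ++ x :: s2) = 0.
  elim: t u => [|y t IH] u pu; first by apply: (step2 s2 u [::]).
  have ext (b : bool) z : (if b then type10 I z else type01 I z) -> pure (rcons u (b, z)).
    by move=> h b' z'; rewrite mem_rcons inE => /orP[/eqP[-> ->]|/pu].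
  have e (b : bool) z : (if b then type10 I z else type01 I z) ->
      a (unzip2 u ++ z :: t ++ x :: s2) = 0.
    move=> h; have := IH (rcons u (b, z)) (ext _ _ h).
    by rewrite [unzip2 (rcons _ _)]map_rcons /= cat_rcons.
  rewrite (proj_sum y) cat_cons (multiD _ _ _ _ ma).
  by rewrite (e true) ?(e false) ?addr0; [|exact: proj01_type|exact: proj10_type].
exact: (step1 s1 [::]).
Qed.

Lemma kills01_bidegree p a : is_form p a -> kills01 a -> bidegree p 0 a.
Proof.
move=> fa ha; split=> [|u pu hu]; first by rewrite addn0.
have [nf|/allPn[[b x] ux /= nb]] := boolP (all (fun bx => bx.1) u).
  apply: (form_size fa) => sz; apply: hu.
  have eid : all id (unzip1 u) by rewrite all_map.
  have := count_predC id (unzip1 u); move: eid; rewrite all_count => /eqP ->.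
  rewrite size_map -[X in _ = X]addn0 => /addnI e0.
  by rewrite -sz size_map; congr (_, _).
have := pu _ _ ux; rewrite (negbTE nb) => tx.
have : x \in unzip2 u by apply/mapP; exists (b, x).
by case/splitPr => s1 s2; apply: ha.
Qed.

Definition pb10 (a : T) : T := fun s => a (map proj10 s).

Lemma kills01_pb10 a : multi a -> kills01 a -> pb10 a = a.
Proof.
move=> m ha; apply/funext => s; rewrite /pb10.
suff h t : a (t ++ map proj10 s) = a (t ++ s) by exact: (h [::]).
elim: s t => [|x s IH] t //=.
rewrite {2}(proj_sum x) (multiD _ _ _ _ m) (ha t s _ (proj01_type x)).
by rewrite addr0 -!cat_rcons IH.
Qed.

Lemma pb10_kills01 a : multi a -> kills01 (pb10 a).
Proof.
move=> m s1 s2 x tx; rewrite /pb10 map_cat /=.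
suff -> : proj10 x = 0 by apply: multi0.
by rewrite /proj10 tx scalerA mulrN ii opprK scale1r subrr scaler0.
Qed.

Lemma proj_type_pb10 p a : (forall s, size s <> p -> a s = 0) ->
  proj_type p a = pb10 a.
Proof.
move=> ha; apply/funext => s; rewrite /proj_type /pb10.
have [/eqP sp|/eqP sp] := boolP (size s == p); last first.
  rewrite (ha (map _ _)) ?size_map // big1 // => m _.
  by rewrite ha // size_map size_zip size_tuple minnn.
subst p; rewrite (big_pred1 [tuple of nseq (size s) true]) /=.
  congr a; elim: s {ha} => //= x s ->; by [].
move=> m /=; rewrite -[X in _ == X](size_tuple m) -all_count.
rewrite (@eq_all _ id (pred1 true)); last by case.
apply/all_pred1P/eqP => [e|-> /=]; last by rewrite size_nseq.
by apply: val_inj; rewrite /= e size_tuple.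
Qed.

Lemma rd_size p a : (forall s, size s <> p -> a s = 0) ->
  forall s, size s <> p.+1 -> rd a s = 0.
Proof.
have lie_size x s : forall q a, (forall s, size s <> q -> a s = 0) ->
    size s <> q -> lier x s a = 0.
  elim: s => [|y s IH] q b hb /= hs; first by rewrite hb // vf0.
  rewrite hb // subr0; case: q hb hs => [|q] hb hs.
    by apply: (IH (size s).+1) => [t _|]; [rewrite /ins hb|elim: (size s)].
  apply: (IH q) => [t ht|e]; last by apply: hs; rewrite e.
  by rewrite /ins hb //= => -[].
move=> ha s; elim: s p a ha => [|x s IH] p a ha //= hs.
rewrite /rd /= /lie (lie_size _ _ p) //; last by move=> e; apply: hs; rewrite e.
case: p ha hs => [|p] ha hs.
  rewrite (_ : ins x a = 0); last by apply/funext => t; rewrite /ins ha.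
  by have := rdrD s 0 0; rewrite addr0 sub0r => /eqP;
    rewrite -subr_eq0 opprD addNKr => /eqP.
rewrite -[rdr _ _]/(rd (ins x a) s) (IH p) ?subr0 // => [t ht|e].
  by rewrite /ins ha //= => -[].
by apply: hs; rewrite /= e.
Qed.

Lemma pb10_is_form k a : is_form k a -> is_form k (pb10 a).
Proof.
move=> /is_formP[a1 a2 a3]; apply/is_formP; rewrite /pb10; split.
- by move=> s hs; rewrite a1 ?size_map.
- move=> s1 s2 f x y; rewrite !map_cat /=.
  rewrite -a2; congr (a (_ ++ _ :: _)); rewrite /proj10 linearP.
  by apply: vf_ext => g; rewrite !(vfSE, vfAE, vfNE); ring.
- by move=> s1 s2 x; rewrite map_cat /= a3.
Qed.

Lemma extd_form p a : is_form p a -> is_form p.+1 (extd a).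
Proof.
move=> /is_formP[a1 a2 a3]; apply/is_formP; rewrite extdE //; split.
- exact: rd_size.
- exact: rd_multi.
- exact: rd_alt1.
Qed.

Lemma dolbE p a : is_form p a -> dolb p a = pb10 (rd a).
Proof.
move=> fa; have [_ a2 a3] := (is_formP _ _).1 fa.
rewrite /dolb proj_type_pb10; last exact: (form_size (extd_form fa)).
by rewrite extdE.
Qed.

Lemma bidegree0_form p a : bidegree p 0 a -> is_form p a.
Proof. by case; rewrite addn0. Qed.

Lemma bidegree_pb10 p a : bidegree p 0 a -> pb10 a = a.
Proof.
move=> ha; apply: kills01_pb10; last exact: bidegree_kills01 ha.
by have /is_formP[] := bidegree0_form ha.
Qed.

Lemma dolb_bidegree p a : bidegree p 0 a -> bidegree p.+1 0 (dolb p a).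
Proof.
move=> ha; have fa := bidegree0_form ha; have [_ a2 a3] := (is_formP _ _).1 fa.
rewrite dolbE // -extdE //; apply: kills01_bidegree.
  exact/pb10_is_form/extd_form.
by apply: pb10_kills01; have /is_formP[] := extd_form fa.
Qed.

Lemma wedge_kills01 a b : kills01 a -> kills01 b -> kills01 (wedge a b).
Proof.
move=> ha hb s1; elim: s1 a b ha hb => [|y s1 IH] a b ha hb s2 x tx.
  rewrite wedgeE /= (_ : ins x a = 0); last by apply/funext => t; exact: (ha [::]).
  rewrite (_ : ins x b = 0); last by apply/funext => t; exact: (hb [::]).
  by rewrite wedge01 wedge02 addr0.
have -> : wedge a b ((y :: s1) ++ x :: s2) =
    (wedge (ins y a) b + wedge (sgn a) (ins y b)) (s1 ++ x :: s2).
  by rewrite -ins_wedge.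
have hi c : kills01 c -> kills01 (ins y c) by move=> hc t1 t2; exact: (hc (y :: t1)).
have hs c : kills01 c -> kills01 (sgn c).
  by move=> hc t1 t2 z tz; rewrite /sgn hc // mulr0.
by rewrite !fctE !IH ?addr0 //; auto.
Qed.

Lemma wedge_bidegree p q a b : bidegree p 0 a -> bidegree q 0 b ->
  bidegree (p + q) 0 (wedge a b).
Proof.
move=> ha hb; apply: kills01_bidegree.
  by apply: wedge_form; exact: bidegree0_form.
by apply: wedge_kills01; [exact: bidegree_kills01 ha|exact: bidegree_kills01 hb].
Qed.

Lemma one_bidegree : bidegree 0 0 (@cochain_one R M).
Proof.
apply: kills01_bidegree; last by case=> [|? ?].
split=> [[|? ?] //|[|? ?] *|[|? ?] *] //=; by rewrite mulr0 addr0.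
Qed.

Lemma pb10_wedge a b : pb10 (wedge a b) = wedge (pb10 a) (pb10 b).
Proof.
apply/funext => s; rewrite /pb10 /wedge size_map.
by apply: eq_bigr => m _; rewrite !map_mask.
Qed.

Lemma pb10_rd_vanish a : (forall s, (forall x, x \in s -> type10 I x) -> a s = 0) ->
  forall s, (forall x, x \in s -> type10 I x) -> rd a s = 0.
Proof.
have lie_v x s : type10 I x -> (forall y, y \in s -> type10 I y) ->
    forall a, (forall s, (forall x, x \in s -> type10 I x) -> a s = 0) ->
    lier x s a = 0.
  move=> tx; elim: s => [|y s IH] ts b hb /=; first by rewrite hb // vf0.
  have ty : type10 I y by apply: ts; rewrite mem_head.
  have ts' z : z \in s -> type10 I z by move=> zs; apply: ts; rewrite inE zs orbT.
  rewrite hb ?subr0; last first.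
    move=> z; rewrite inE => /orP[/eqP ->|/ts' //].
    exact: (cs_integrable (hcI_complex H)).
  apply: IH => // t ht; apply: hb => z; rewrite inE => /orP[/eqP -> //|/ht //].
move=> ha s; elim: s a ha => [|x s IH] a ha ts //; rewrite /rd /= /lie.
have tx : type10 I x by apply: ts; rewrite mem_head.
have ts' z : z \in s -> type10 I z by move=> zs; apply: ts; rewrite inE zs orbT.
rewrite lie_v // sub0r -[rdr _ _]/(rd (ins x a) s) IH ?oppr0 // => t ht.
by apply: ha => z; rewrite inE => /orP[/eqP -> //|/ht //].
Qed.

Lemma rd_sub a b : rd (a - b) = rd a - rd b.
Proof. by apply/funext => s; rewrite /rd rdrB. Qed.

Lemma dolb_dolb p a : bidegree p 0 a -> dolb p.+1 (dolb p a) = 0.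
Proof.
move=> ha; have fa := bidegree0_form ha; have [_ a2 a3] := (is_formP _ _).1 fa.
rewrite dolbE; last exact: bidegree0_form (dolb_bidegree ha).
rewrite dolbE //; apply/funext => s.
have t10 x : x \in map proj10 s -> type10 I x.
  by case/mapP => y _ ->; exact: proj10_type.
have := @pb10_rd_vanish (pb10 (rd a) - rd a) _ _ t10.
rewrite rd_sub !fctE [rd (rd a) _]/rd rd_rd // subr0; apply.
move=> t ht; rewrite /pb10 (_ : map _ t = t) ?subrr //.
elim: t ht => //= x t IH ht; rewrite proj10_id ?IH // => [y yt|]; apply: ht.
  by rewrite inE yt orbT.
exact: mem_head.
Qed.

Lemma bidegree_sgn p a : bidegree p 0 a -> sgn a = (-1) ^+ p *: a.
Proof.
move=> /bidegree0_form fa; apply/funext => s; rewrite /sgn cmulE /cmul.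
rewrite rmorphXn rmorphN1.
by have [->//|/eqP np] := eqVneq (size s) p; rewrite (form_size fa) // !mulr0.
Qed.

Lemma dolb_wedge p q a b : bidegree p 0 a -> bidegree q 0 b ->
  dolb (p + q) (wedge a b) =
  wedge (dolb p a) b + (-1) ^+ p *: wedge a (dolb q b).
Proof.
move=> ha hb; have fa := bidegree0_form ha; have fb := bidegree0_form hb.
rewrite !dolbE //; last exact: wedge_form.
rewrite (_ : rd (wedge a b) = wedge (rd a) b + wedge (sgn a) (rd b)); last first.
  by apply/funext => s; rewrite fctE !wedgeE -rd_wedge.
rewrite -[pb10 (_ + _)]/(pb10 (wedge _ _) + pb10 (wedge _ _)) !pb10_wedge.
rewrite (bidegree_sgn ha) -[pb10 (_ *: _)]/((-1) ^+ p *: pb10 a).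
rewrite (bidegree_pb10 ha) (bidegree_pb10 hb); congr (_ + _).
by apply/funext => s; rewrite !cmulE /cmul !wedgeE wedgeZ1.
Qed.

Lemma rdZ (c : R[i]) a : rd (c *: a) = c *: rd a.
Proof.
apply/funext => s; rewrite !cmulE /rd rdrZ /cmul -[RHS]addr0; congr (_ + _).
by elim: s a => //= x s IH a; rewrite vf_const mul0r sub0r IH oppr0.
Qed.

Definition p0_pred (p : nat) : {pred T} := [pred a | `[< bidegree p 0 a >]].

Lemma p0P p a : reflect (bidegree p 0 a) (a \in p0_pred p).
Proof. exact: asboolP. Qed.

Lemma p0_submod p : submod_closed (p0_pred p).
Proof.
split=> [|c a b /p0P ha /p0P hb]; apply/p0P; apply: kills01_bidegree => //.
- by split=> // *; rewrite /= mulr0 addr0.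
- have [a1 a2 a3] := bidegree0_form ha; have [b1 b2 b3] := bidegree0_form hb.
  have e t : (c *: a + b) t = smooth_const M c * a t + b t by [].
  split=> [s hs|s1 s2 f x y|s1 s2 s3 x]; rewrite !e.
  + by rewrite a1 // b1 // mulr0 addr0.
  + by rewrite a2 b2; ring.
  + by rewrite a3 b3 mulr0 addr0.
- move=> s1 s2 x tx; have e t : (c *: a + b) t = smooth_const M c * a t + b t by [].
  by rewrite e (bidegree_kills01 ha) // (bidegree_kills01 hb) // mulr0 addr0.
Qed.

Lemma dolbP p (c : R[i]) a b : bidegree p 0 a -> bidegree p 0 b ->
  dolb p (c *: a + b) = c *: dolb p a + dolb p b.
Proof.
move=> ha hb; have /p0P hab : c *: a + b \in p0_pred p.
  by have [_ h] := p0_submod p; apply: h; apply/p0P.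
rewrite !dolbE; try exact: bidegree0_form.
have -> : rd (c *: a + b) = c *: rd a + rd b.
  by rewrite -rdZ; apply/funext => s; rewrite /rd rdrD.
by [].
Qed.

(* A^{p,0}(M) *)
Record p0_form (p : nat) := P0Form {
  p0_val :> T;
  p0_valP : p0_val \in p0_pred p }.

HB.instance Definition _ p := [isSub for @p0_val p].
HB.instance Definition _ p := [Choice of p0_form p by <:].
HB.instance Definition _ p :=
  GRing.SubChoice_isSubLmodule.Build _ _ _ (p0_form p) (p0_submod p).

Lemma p0_form_bidegree p (a : p0_form p) : bidegree p 0 a.
Proof. exact/p0P/p0_valP. Qed.

Definition p0_one : p0_form 0 := P0Form (introT (p0P _ _) one_bidegree).

Definition p0_wedge p q (a : p0_form p) (b : p0_form q) : p0_form (p + q) :=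
  P0Form (introT (p0P _ _)
    (wedge_bidegree (p0_form_bidegree a) (p0_form_bidegree b))).

Definition p0_dolb p (a : p0_form p) : p0_form p.+1 :=
  P0Form (introT (p0P _ _) (dolb_bidegree (p0_form_bidegree a))).

Lemma p0_cast p q (e : p = q) (a : p0_form p) :
  val (ecast n (p0_form n) e a) = val a.
Proof. by case: _ / e. Qed.

Lemma p0_lin p (c : R[i]) (a b : p0_form p) :
  p0_val (c *: a + b) = c *: p0_val a + p0_val b.
Proof. by []. Qed.

Fact p0_mulPl p q (c : R[i]) (a b : p0_form p) (d : p0_form q) :
  p0_wedge (c *: a + b) d = c *: p0_wedge a d + p0_wedge b d.
Proof.
apply: val_inj; apply/funext => s.
rewrite -[LHS]/(wedge (c *: p0_val a + p0_val b) d s).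
rewrite -[RHS]/(smooth_const M c * wedge a d s + wedge b d s).
by rewrite wedgeE cmulE wedgeD1 wedgeZ1 !wedgeE.
Qed.
Fact p0_mulPr p q (c : R[i]) (a : p0_form p) (b d : p0_form q) :
  p0_wedge a (c *: b + d) = c *: p0_wedge a b + p0_wedge a d.
Proof.
apply: val_inj; apply/funext => s.
rewrite -[LHS]/(wedge a (c *: p0_val b + p0_val d) s).
rewrite -[RHS]/(smooth_const M c * wedge a b s + wedge a d s).
by rewrite wedgeE cmulE wedgeD2 wedgeZ2 !wedgeE.
Qed.
Fact p0_mulA p q r (a : p0_form p) (b : p0_form q) (d : p0_form r) :
  p0_wedge (p0_wedge a b) d =
  ecast n (p0_form n) (addnA p q r) (p0_wedge a (p0_wedge b d)).
Proof. by apply: val_inj; rewrite p0_cast /= wedgeA. Qed.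
Fact p0_mul1l p (a : p0_form p) : p0_wedge p0_one a = a.
Proof. by apply: val_inj; rewrite /= wedge_onel. Qed.
Fact p0_mul1r p (a : p0_form p) :
  p0_wedge a p0_one = ecast n (p0_form n) (esym (addn0 p)) a.
Proof. by apply: val_inj; rewrite p0_cast /= wedge_oner. Qed.
Fact p0_diffP p (c : R[i]) (a b : p0_form p) :
  p0_dolb (c *: a + b) = c *: p0_dolb a + p0_dolb b.
Proof.
by apply: val_inj; rewrite /= dolbP //; exact: p0_form_bidegree.
Qed.
Fact p0_diffK p (a : p0_form p) : p0_dolb (p0_dolb a) = 0.
Proof.
by apply: val_inj; rewrite /= dolb_dolb //; exact: p0_form_bidegree.
Qed.
Fact p0_leibniz p q (a : p0_form p) (b : p0_form q) :
  p0_dolb (p0_wedge a b) =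
  p0_wedge (p0_dolb a) b +
  (-1) ^+ p *: ecast n (p0_form n) (addnS p q) (p0_wedge a (p0_dolb b)).
Proof.
apply: val_inj; rewrite addrC -[LHS]/(dolb (p + q) (wedge a b)).
rewrite -[RHS]/((-1) ^+ p *: val (ecast n (p0_form n) (addnS p q)
  (p0_wedge a (p0_dolb b))) + wedge (dolb p a) b) p0_cast addrC.
by rewrite dolb_wedge //; exact: p0_form_bidegree.
Qed.

Definition dolbeault_dga : dga R[i] :=
  @DGA R[i] (fun p => p0_form p : lmodType R[i]) p0_one p0_wedge p0_dolb
    p0_mulPl p0_mulPr p0_mulA p0_mul1l p0_mul1r p0_diffP p0_diffK p0_leibniz.

End Dolbeault.

(* Main.v *)
(* Write d = \partial and d_J = \partial_J on A^{p,0}(M). If d and d_J are anticommuting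
   derivations, the dd_J-lemma makes both arrows of
     (A, d) <- (ker d_J, d) -> (ker d_J / im d_J, 0)
   quasi-isomorphisms, as for compact Kaehler manifolds. Both d_J and d + d_J are
   restrictions of the exterior derivative to involutive distributions, namely the
   (0,1)-fields of I and the (1,0)-fields of K, transported to the (1,0)-fields of I by
   x |-> - J x and x |-> x - J x. Hence both square to zero, and d and d_J anticommute. *)
From HB Require Import structures.
Require Import Defs.
From mathcomp Require Import all_boot all_order all_algebra.
From mathcomp Require Import generic_quotient ring_quotient complex ring.
From mathcomp Require Import boolp classical_sets functions reals topology.

Set Implicit Arguments.
Unset Strict Implicit.
Unset Printing Implicit Defensive.

Import Order.TTheory GRing.Theory Num.Theory.

Local Open Scope classical_set_scope.
Local Open Scope ring_scope.
Local Open Scope quotient_scope.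

(** * Formality from two anticommuting differentials *)

Lemma ecast0 (C : fieldType) (V : nat -> lmodType C) p q (e : p = q) :
  ecast n (V n) e 0 = 0.
Proof. by case: _ / e. Qed.

Section LinearOn.
Variables (C : fieldType) (U V : lmodType C) (f : U -> V).
Hypothesis flin : forall (c : C) x y, f (c *: x + y) = c *: f x + f y.

Lemma linear_on0 : f 0 = 0.
Proof. by apply: (addrI (f 0)); rewrite -{1}[f 0]scale1r -flin scaler0 !addr0. Qed.

Lemma linear_onD x y : f (x + y) = f x + f y.
Proof. by rewrite -{1}[x]scale1r flin scale1r. Qed.

Lemma linear_onZ c x : f (c *: x) = c *: f x.
Proof. by rewrite -[c *: x]addr0 flin linear_on0 addr0. Qed.

Lemma linear_onB x y : f (x - y) = f x - f y.
Proof. by rewrite linear_onD -scaleN1r linear_onZ scaleN1r. Qed.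

End LinearOn.

Section DGATheory.
Variables (C : fieldType) (A : dga C).

Lemma dga_mul0l p q (y : A q) : dga_mul (0 : A p) y = 0.
Proof. exact: (linear_on0 (fun c u v => dga_mulPl c u v y)). Qed.

Lemma dga_mul0r p q (x : A p) : dga_mul x (0 : A q) = 0.
Proof. exact: (linear_on0 (fun c => dga_mulPr c x)). Qed.

End DGATheory.

Record bidga (C : fieldType) := BiDGA {
  bidga_dga :> dga C;
  diffJ : forall p, bidga_dga p -> bidga_dga p.+1;
  diffJP : forall p (c : C) (x y : bidga_dga p),
    diffJ (c *: x + y) = c *: diffJ x + diffJ y;
  diffJK : forall p (x : bidga_dga p), diffJ (diffJ x) = 0;
  diffJ_one : diffJ (dga_one bidga_dga) = 0;
  diffJ_leibniz : forall p q (x : bidga_dga p) (y : bidga_dga q),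
    diffJ (dga_mul x y) =
    dga_mul (diffJ x) y +
    (-1) ^+ p *: ecast n (bidga_dga n) (addnS p q) (dga_mul x (diffJ y));
  diff_diffJ : forall p (x : bidga_dga p),
    dga_diff (diffJ x) = - diffJ (dga_diff x) }.

Section BiDGA.
Variables (C : fieldType) (A : bidga C).

Definition coboundaryJ p : A p -> Prop :=
  if p is q.+1 then fun x => exists y : A q, x = diffJ y else fun x => x = 0.

(** The operator $d d_J$ raises the degree by two, so its image is zero in degrees 0 and 1, which
    both fall under [else]. *)
Definition coboundary2 p : A p -> Prop :=
  if p is q.+2 then fun x => exists y : A q, x = dga_diff (diffJ y)
  else fun x => x = 0.

Lemma coboundaryJ0 p : coboundaryJ (0 : A p).
Proof. by case: p => //= p; exists 0; rewrite (linear_on0 (@diffJP C A p)). Qed.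

Lemma coboundaryJP p (c : C) (x y : A p) :
  coboundaryJ x -> coboundaryJ y -> coboundaryJ (c *: x + y).
Proof.
case: p x y => [|p] x y /= => [-> ->|[u ->] [v ->]]; first by rewrite scaler0 addr0.
by exists (c *: u + v); rewrite diffJP.
Qed.

Lemma coboundaryJ_ecast p q (e : p = q) (x : A p) :
  coboundaryJ x -> coboundaryJ (ecast n (A n) e x).
Proof. by case: _ / e. Qed.

Lemma coboundaryJ_mull p q (x : A p) (y : A q) :
  coboundaryJ x -> diffJ y = 0 -> coboundaryJ (dga_mul x y).
Proof.
case: p x => [|p] x /= => [-> _|[u ->] dy]; first by rewrite dga_mul0l; exact: coboundaryJ0.
by exists (dga_mul u y); rewrite diffJ_leibniz dy dga_mul0r ecast0 scaler0 addr0.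
Qed.

(** Since $d_J x = 0$, the Leibniz rule gives $x \, d_J u = (-1)^p d_J(x u)$. *)
Lemma coboundaryJ_mulr p q (x : A p) (y : A q) :
  diffJ x = 0 -> coboundaryJ y -> coboundaryJ (dga_mul x y).
Proof.
case: q y => [|q] y /= => [_ ->|dx [u ->]]; first by rewrite dga_mul0r; exact: coboundaryJ0.
(* The sign in the witness cancels the Leibniz sign. The degrees [(p + q).+1] and [p + q.+1] are not
   convertible, hence the transport along [addnS] below. *)
have : @coboundaryJ (p + q).+1 (diffJ ((-1) ^+ p *: dga_mul x u)) by eexists.
rewrite (linear_onZ (@diffJP C A _)) diffJ_leibniz dx dga_mul0l add0r.
rewrite scalerA -expr2 sqrr_sign scale1r.
move/(coboundaryJ_ecast (esym (addnS p q))).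
by case: _ / (addnS p q) (dga_mul x _).
Qed.

(** * The sub-DGA $\ker d_J$ *)

Definition kerJ_pred p : {pred A p} := [pred x | `[< diffJ x = 0 >]].

Lemma kerJP p (x : A p) : reflect (diffJ x = 0) (x \in @kerJ_pred p).
Proof. exact: asboolP. Qed.

Fact kerJ_submod p : submod_closed (@kerJ_pred p).
Proof.
split=> [|c x y /kerJP dx /kerJP dy]; apply/kerJP; first exact: (linear_on0 (@diffJP C A p)).
by rewrite diffJP dx dy scaler0 addr0.
Qed.

Record kerJ p := KerJ { kerJ_val :> A p; kerJ_valP : kerJ_val \in @kerJ_pred p }.

HB.instance Definition _ p := [isSub for @kerJ_val p].
HB.instance Definition _ p := [Choice of kerJ p by <:].
HB.instance Definition _ p :=
  GRing.SubChoice_isSubLmodule.Build _ _ _ (kerJ p) (kerJ_submod p).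

Lemma diffJ_kerJ p (x : kerJ p) : diffJ (val x) = 0.
Proof. exact/kerJP/kerJ_valP. Qed.

Lemma kerJ_valE p (c : C) (x y : kerJ p) : val (c *: x + y) = c *: val x + val y.
Proof. by []. Qed.

Definition to_kerJ p (x : A p) (dx : diffJ x = 0) : kerJ p := KerJ (introT (kerJP _) dx).

Fact kerJ_mul_subproof p q (x : kerJ p) (y : kerJ q) :
  diffJ (dga_mul (val x) (val y)) = 0.
Proof.
by rewrite diffJ_leibniz !diffJ_kerJ dga_mul0l dga_mul0r ecast0 scaler0 addr0.
Qed.

Fact kerJ_diff_subproof p (x : kerJ p) : diffJ (dga_diff (val x)) = 0.
Proof.
by apply/eqP; rewrite -oppr_eq0 -diff_diffJ diffJ_kerJ (linear_on0 (@dga_diffP C A _)).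
Qed.

Definition kerJ_one : kerJ 0 := to_kerJ (diffJ_one A).
Definition kerJ_mul p q (x : kerJ p) (y : kerJ q) : kerJ (p + q) :=
  to_kerJ (kerJ_mul_subproof x y).
Definition kerJ_diff p (x : kerJ p) : kerJ p.+1 := to_kerJ (kerJ_diff_subproof x).

Lemma kerJ_ecast p q (e : p = q) (x : kerJ p) :
  val (ecast n (kerJ n) e x) = ecast n (A n) e (val x).
Proof. by case: _ / e. Qed.

Definition kerJ_dga : dga C.
Proof.
refine (@DGA C (fun p => kerJ p : lmodType C) kerJ_one kerJ_mul kerJ_diff
  _ _ _ _ _ _ _ _).
- by move=> p q c x y z; apply: val_inj; exact: dga_mulPl.
- by move=> p q c x y z; apply: val_inj; exact: dga_mulPr.
- by move=> p q r x y z; apply: val_inj; rewrite kerJ_ecast /= dga_mulA.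
- by move=> p x; apply: val_inj; rewrite /= dga_mul1l.
- by move=> p x; apply: val_inj; rewrite kerJ_ecast /= dga_mul1r.
- by move=> p c x y; apply: val_inj; exact: dga_diffP.
- by move=> p x; apply: val_inj; rewrite /= dga_diffK.
(* The sum is swapped so that the scaled summand comes first, as [kerJ_valE] expects, and then
   swapped back. *)
- move=> p q x y; apply: val_inj; rewrite addrC kerJ_valE kerJ_ecast addrC.
  exact: dga_leibniz.
Defined.

Definition kerJ_incl : dga_hom kerJ_dga A.
Proof. by refine (@DGAHom C kerJ_dga A (fun p x => val (x : kerJ p)) _ _ _ _). Defined.

(** * The quotient algebra $\ker d_J / \mathrm{im}\, d_J$ *)

Definition imJ_pred p : {pred kerJ p} := [pred x | `[< coboundaryJ (val x) >]].

Lemma imJP p (x : kerJ p) : reflect (coboundaryJ (val x)) (x \in @imJ_pred p).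
Proof. exact: asboolP. Qed.

Fact imJ_zmod p : zmod_closed (@imJ_pred p).
Proof.
split=> [|x y /imJP hx /imJP hy]; apply/imJP; first exact: coboundaryJ0.
by rewrite addrC -scaleN1r; exact: coboundaryJP.
Qed.
HB.instance Definition _ p :=
  GRing.isZmodClosed.Build _ (@imJ_pred p) (imJ_zmod p).

(** The quotient is one of additive groups; scalars and products are put on it afterwards through
    the representatives [repr]. *)
Definition cohJ p := Quotient.quot (@imJ_pred p : zmodClosed (kerJ p)).
HB.instance Definition _ p := GRing.Zmodule.on (cohJ p).

Definition clJ p (x : kerJ p) : cohJ p := \pi_(cohJ p) x.

Lemma clJ_eq p (x y : kerJ p) : clJ x = clJ y <-> coboundaryJ (val x - val y).
Proof.
rewrite -[val x - val y]/(val (x - y)); split.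
  by move=> /eqP e; apply/imJP; rewrite Quotient.idealrBE.
by move=> /imJP; rewrite Quotient.idealrBE => /eqP.
Qed.

Lemma clJ_surj p (u : cohJ p) : clJ (repr u) = u.
Proof. exact: reprK. Qed.

Lemma clJ0 p : clJ (0 : kerJ p) = 0.
Proof. exact: (raddf0 (\pi_(cohJ p))). Qed.

Lemma clJD p (x y : kerJ p) : clJ (x + y) = clJ x + clJ y.
Proof. exact: (raddfD (\pi_(cohJ p))). Qed.

Definition cohJ_scale p (c : C) (u : cohJ p) : cohJ p := clJ (c *: repr u).

(** The scalar action is well defined because $\mathrm{im}\, d_J$ is stable under scaling. With
    [clJ_surj], this carries the module axioms over from [kerJ]. *)
Lemma clJZ p (c : C) (x : kerJ p) : clJ (c *: x) = cohJ_scale c (clJ x).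
Proof.
apply/clJ_eq; rewrite -[_ - _]/(val (c *: x - c *: repr (clJ x))) -scalerBr.
rewrite -[c *: _]addr0; apply: coboundaryJP; last exact: coboundaryJ0.
by apply/clJ_eq; rewrite clJ_surj.
Qed.

Fact cohJ_scaleA p a b (u : cohJ p) :
  cohJ_scale a (cohJ_scale b u) = cohJ_scale (a * b) u.
Proof. by rewrite -[u]clJ_surj -!clJZ scalerA. Qed.
Fact cohJ_scale1 p : left_id 1 (@cohJ_scale p).
Proof. by move=> u; rewrite -[u]clJ_surj -clJZ scale1r. Qed.
Fact cohJ_scaleDr p : right_distributive (@cohJ_scale p) +%R.
Proof.
by move=> a u v; rewrite -[u]clJ_surj -[v]clJ_surj -clJD -!clJZ scalerDr clJD.
Qed.
Fact cohJ_scaleDl p (u : cohJ p) : {morph (@cohJ_scale p)^~ u : a b / a + b}.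
Proof. by move=> a b; rewrite -[u]clJ_surj -!clJZ scalerDl clJD. Qed.
HB.instance Definition _ p := GRing.Zmodule_isLmodule.Build C (cohJ p)
  (@cohJ_scaleA p) (@cohJ_scale1 p) (@cohJ_scaleDr p) (@cohJ_scaleDl p).

Lemma clJ_lin p (c : C) (x y : kerJ p) : clJ (c *: x + y) = c *: clJ x + clJ y.
Proof. by rewrite clJD clJZ. Qed.

Definition cohJ_mul p q (u : cohJ p) (v : cohJ q) : cohJ (p + q) :=
  clJ (kerJ_mul (repr u) (repr v)).

(** The product is well defined because $\mathrm{im}\, d_J$ is a two-sided ideal of $\ker d_J$: $xy
    - x'y' = (x - x')y + x'(y - y')$. *)
Lemma clJ_mul p q (x : kerJ p) (y : kerJ q) :
  clJ (kerJ_mul x y) = cohJ_mul (clJ x) (clJ y).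
Proof.
apply/clJ_eq => /=; set x' := repr _; set y' := repr _.
have -> : dga_mul (val x) (val y) - dga_mul (val x') (val y') =
    1 *: dga_mul (val x - val x') (val y) + dga_mul (val x') (val y - val y').
  rewrite scale1r (linear_onB (fun c u v => dga_mulPl c u v (val y))).
  by rewrite (linear_onB (fun c => dga_mulPr c (val x'))) addrA subrK.
apply: coboundaryJP.
  apply: coboundaryJ_mull (diffJ_kerJ y); apply/clJ_eq; exact/esym/clJ_surj.
apply: coboundaryJ_mulr (diffJ_kerJ x') _; apply/clJ_eq; exact/esym/clJ_surj.
Qed.

Lemma clJ_ecast p q (e : p = q) (x : kerJ p) :
  clJ (ecast n (kerJ n) e x) = ecast n (cohJ n) e (clJ x).
Proof. by case: _ / e. Qed.

Fact cohJ_mulPl p q (c : C) (x y : cohJ p) (z : cohJ q) :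
  cohJ_mul (c *: x + y) z = c *: cohJ_mul x z + cohJ_mul y z.
Proof.
rewrite -[x]clJ_surj -[y]clJ_surj -[z]clJ_surj -clJ_lin -!clJ_mul -clJ_lin.
congr clJ; exact: (dga_mulPl (d := kerJ_dga)).
Qed.

Fact cohJ_mulPr p q (c : C) (x : cohJ p) (y z : cohJ q) :
  cohJ_mul x (c *: y + z) = c *: cohJ_mul x y + cohJ_mul x z.
Proof.
rewrite -[x]clJ_surj -[y]clJ_surj -[z]clJ_surj -clJ_lin -!clJ_mul -clJ_lin.
congr clJ; exact: (dga_mulPr (d := kerJ_dga)).
Qed.

Definition cohJ_dga : dga C.
Proof.
refine (@DGA C (fun p => cohJ p : lmodType C) (clJ kerJ_one) cohJ_mul
  (fun p _ => 0) cohJ_mulPl cohJ_mulPr _ _ _ _ _ _).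
(* Associativity and the unit laws are those of [kerJ_dga], read on representatives. *)
- move=> p q r x y z; rewrite -[x]clJ_surj -[y]clJ_surj -[z]clJ_surj.
  rewrite -!clJ_mul -clJ_ecast; congr clJ; exact: (dga_mulA (d := kerJ_dga)).
- move=> p x; rewrite -[x]clJ_surj -clJ_mul; congr clJ.
  exact: (dga_mul1l (d := kerJ_dga)).
- move=> p x; rewrite -[x]clJ_surj -clJ_mul -clJ_ecast; congr clJ.
  exact: (dga_mul1r (d := kerJ_dga)).
- by move=> p c x y; rewrite scaler0 addr0.
- by [].
- move=> p q x y; rewrite (linear_on0 (fun c u v => cohJ_mulPl c u v y)).
  rewrite (linear_on0 (fun c => cohJ_mulPr c x)).
  by rewrite (ecast0 (fun n => cohJ n : lmodType C)) scaler0 addr0.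
Defined.

(** * The two quasi-isomorphisms given by the $d d_J$-lemma *)

Hypothesis ddJ1 : forall p (x : A p), coboundary x -> diffJ x = 0 -> coboundary2 x.
Hypothesis ddJ2 : forall p (x : A p), coboundaryJ x -> dga_diff x = 0 -> coboundary2 x.

Lemma coboundary_diff p (x : A p) : coboundary (dga_diff x).
Proof. by exists x. Qed.

(** By anticommutation, $d d_J y = d_J(-d y)$. *)
Lemma coboundary2_J p (x : A p) : coboundary2 x -> coboundaryJ x.
Proof.
case: p x => [|[|p]] x //= => [->|[y ->]]; first exact: (@coboundaryJ0 1).
exists (- dga_diff y).
by rewrite -scaleN1r (linear_onZ (@diffJP C A _)) scaleN1r diff_diffJ.
Qed.

Lemma kerJ_incl_quasi_iso : quasi_iso kerJ_incl.
Proof.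
move=> p; split=> [x cx bx|y cy].
  (* Injectivity: $x$ lies in $\mathrm{im}\, d \cap \ker d_J$, so $x = d(d_J y)$ with $d_J y$ again
     in $\ker d_J$. In degrees 0 and 1 this reads $x = 0$. *)
  have := ddJ1 bx (diffJ_kerJ x); case: p x {cx bx} => [|[|p]] x /=.
  - by move=> e; exact: val_inj.
  - move=> e; exists 0; apply: val_inj.
    by rewrite /= e (linear_on0 (@dga_diffP C A _)).
  - by case=> y e; exists (to_kerJ (diffJK y)); exact: val_inj.
(* Surjectivity: $d_J y$ is $d_J$-exact and $d$-closed, so $d_J y = d d_J z$, and $y + dz$ is a
   $d_J$-closed representative of the class of $y$. In degree 0, $d_J y = 0$ and $y$ itself
   serves. *)
have : coboundary2 (diffJ y).
  apply: ddJ2; first by exists y.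
  by rewrite diff_diffJ cy (linear_on0 (@diffJP C A _)) oppr0.
case: p y cy => [|p] y cy /=.
  by move=> dy; exists (to_kerJ dy); [exact: val_inj|rewrite /= subrr].
case=> z ez; have dx : diffJ (y + dga_diff z) = 0.
  by rewrite (linear_onD (@diffJP C A _)) ez diff_diffJ addNr.
exists (to_kerJ dx); last by exists z; rewrite /= addrC addKr.
apply: val_inj.
by rewrite /= (linear_onD (@dga_diffP C A _)) cy dga_diffK addr0.
Qed.

(** As $dx$ lies in $\mathrm{im}\, d \cap \ker d_J$, it is $d_J$-exact; so $d$ induces zero on the
    quotient. *)
Lemma clJ_diff p (x : kerJ p) : clJ (kerJ_diff x) = 0.
Proof.
rewrite -clJ0; apply/clJ_eq; rewrite subr0; apply: coboundary2_J; apply: ddJ1.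
  exact: coboundary_diff.
exact: diffJ_kerJ.
Qed.

Definition kerJ_proj : dga_hom kerJ_dga cohJ_dga.
Proof.
refine (@DGAHom C kerJ_dga cohJ_dga (fun p x => clJ (x : kerJ p)) _ _ _ _).
- by move=> p c x y; exact: clJ_lin.
- by [].
- by move=> p q x y; exact: clJ_mul.
- by move=> p x; exact: clJ_diff.
Defined.

Lemma kerJ_proj_quasi_iso : quasi_iso kerJ_proj.
Proof.
(* The target has zero differential, so a coboundary there is zero. *)
have cob0 p (x : kerJ p) : coboundary (clJ x : cohJ_dga p) -> coboundaryJ (val x).
  move=> h; have e : clJ x = clJ 0.
    by rewrite clJ0; case: p x h => [|p] x //= [].
  by have /clJ_eq := e; rewrite subr0.
move=> p; split=> [x cx /cob0 bx|u _].
  (* Injectivity: $x$ is $d_J$-exact and $d$-closed, so it is $d$ of the $d_J$-closed element $d_J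
     y$. *)
  have cx' : dga_diff (val x) = 0 by exact: (congr1 val cx).
  have := ddJ2 bx cx'; case: p x {cx cx' bx} => [|[|p]] x /=.
  - by move=> e; exact: val_inj.
  - move=> e; exists 0; apply: val_inj.
    by rewrite /= e (linear_on0 (@dga_diffP C A _)).
  - by case=> y e; exists (to_kerJ (diffJK y)); exact: val_inj.
rewrite -[u]clJ_surj; set y := repr u.
have : coboundary2 (dga_diff (val y)).
  by apply: ddJ1; [exact: coboundary_diff|exact: (diffJ_kerJ (kerJ_diff y))].
(* With $dy = d d_J z$, take $w = d_J z$: subtracting it makes $y$ $d$-closed without changing its
   class. *)
move=> d2; have [w [bw dw ew]] : exists w : A p,
    [/\ coboundaryJ w, diffJ w = 0 & dga_diff w = dga_diff (val y)].
  case: p u @y d2 => [|p] u y /=.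
    move=> ->; exists 0; split=> //; first exact: (linear_on0 (@diffJP C A _)).
    exact: (linear_on0 (@dga_diffP C A _)).
  by case=> z ->; exists (diffJ z); split; [exists z|exact: diffJK|].
have dx : diffJ (val y - w) = 0.
  by rewrite (linear_onB (@diffJP C A _)) diffJ_kerJ dw subr0.
exists (to_kerJ dx).
  by apply: val_inj; rewrite /= (linear_onB (@dga_diffP C A _)) ew subrr.
have -> : kerJ_proj p (to_kerJ dx) = clJ y.
  apply/clJ_eq; rewrite /= addrAC subrr sub0r -scaleN1r -[_ *: _]addr0.
  by apply: coboundaryJP => //; exact: coboundaryJ0.
by rewrite subrr; case: p {u y d2 w bw dw ew dx} => //= p; exists 0.
Qed.

Lemma bidga_formal : formal A.
Proof.
exists cohJ_dga; split=> //.
apply: dga_equiv_bwd kerJ_incl_quasi_iso _.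
exact: dga_equiv_fwd kerJ_proj_quasi_iso (dga_equiv_refl _).
Qed.

End BiDGA.

(** * Complex structures and conjugation *)

Section ComplexStructureTheory.
Variables (R : realType) (M : smooth_manifold R).
Local Notation F := (smooth_fun M).
Local Notation X := (vfield M).
Local Notation br := lie_bracket.
Local Notation iF := (smooth_const M 'i%C).
Local Notation halfF := (smooth_const M 2^-1).

Lemma smooth_conjfD (f g : F) : smooth_conjf (f + g) = smooth_conjf f + smooth_conjf g.
Proof. by apply: val_inj; apply/funext => x /=; rewrite !fctE; exact: rmorphD. Qed.
Lemma smooth_conjfN (f : F) : smooth_conjf (- f) = - smooth_conjf f.
Proof. by apply: val_inj; apply/funext => x /=; rewrite !fctE; exact: rmorphN. Qed.
Lemma smooth_conjfM (f g : F) : smooth_conjf (f * g) = smooth_conjf f * smooth_conjf g.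
Proof. by apply: val_inj; apply/funext => x /=; rewrite !fctE; exact: rmorphM. Qed.
Lemma smooth_conjfK (f : F) : smooth_conjf (smooth_conjf f) = f.
Proof. by apply: val_inj; apply/funext => x /=; exact: conjcK. Qed.
Lemma smooth_conjf_const (c : R[i]) :
  smooth_conjf (smooth_const M c) = smooth_const M c^*%C.
Proof. exact: val_inj. Qed.
Lemma smooth_conjf_i : smooth_conjf iF = - iF.
Proof.
rewrite smooth_conjf_const -rmorphN; congr smooth_const.
by apply/eqP; rewrite eq_complex /= oppr0 !eqxx.
Qed.
Lemma smooth_conjf_half : smooth_conjf halfF = halfF.
Proof. by rewrite smooth_conjf_const fmorphV rmorph_nat. Qed.

Fact vconj_subproof (x : X) :
  (fun f => smooth_conjf (x (smooth_conjf f))) \in @derivation_pred R M.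
Proof.
apply/derivationP; split=> [a f g|f g].
  rewrite !fscaleE smooth_conjfD smooth_conjfM smooth_conjf_const -fscaleE.
  by rewrite vfD vfZ fscaleE smooth_conjfD smooth_conjfM -smooth_conjf_const smooth_conjfK.
by rewrite smooth_conjfM vfM smooth_conjfD !smooth_conjfM !smooth_conjfK.
Qed.
(** The complex conjugate field $\bar x$; its fixed points are the real fields. *)
Definition vconj (x : X) : X := VField (vconj_subproof x).

Lemma vconjE (x : X) f : vconj x f = smooth_conjf (x (smooth_conjf f)).
Proof. by []. Qed.
Lemma vconjD x y : vconj (x + y) = vconj x + vconj y.
Proof. by apply: vf_ext => f; rewrite !(vconjE, vfE) smooth_conjfD. Qed.
Lemma vconjN x : vconj (- x) = - vconj x.
Proof. by apply: vf_ext => f; rewrite !(vconjE, vfE) smooth_conjfN. Qed.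
Lemma vconjZ f x : vconj (f *: x) = smooth_conjf f *: vconj x.
Proof. by apply: vf_ext => g; rewrite !(vconjE, vfE) smooth_conjfM. Qed.
Lemma vconjK x : vconj (vconj x) = x.
Proof. by apply: vf_ext => f; rewrite !vconjE !smooth_conjfK. Qed.
Lemma vconj_br x y : vconj (br x y) = br (vconj x) (vconj y).
Proof.
by apply: vf_ext => f; rewrite !(vconjE, vfE) smooth_conjfD smooth_conjfN !smooth_conjfK.
Qed.
Lemma vconj_real x : vconj x = x -> vf_real x.
Proof. by move=> e f; rewrite -{1}e vconjE smooth_conjfK. Qed.
Lemma vf_real_vconj x : vf_real x -> vconj x = x.
Proof. by move=> e; apply: vf_ext => f; rewrite vconjE e smooth_conjfK. Qed.

Variable L : {linear X -> X}.
Hypothesis csL : complex_structure L.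

(* L maps the real and imaginary parts of x to real fields. *)
Lemma cs_vconj x : L (vconj x) = vconj (L x).
Proof.
pose u := halfF *: (x + vconj x); pose v := (- (iF * halfF)) *: (x - vconj x).
have ru : vf_real u.
  by apply: vconj_real; rewrite vconjZ smooth_conjf_half vconjD vconjK addrC.
have rv : vf_real v.
  apply: vconj_real; rewrite vconjZ smooth_conjfN smooth_conjfM smooth_conjf_half.
  rewrite smooth_conjf_i vconjD vconjN vconjK.
  by apply: vf_ext => f; rewrite /v !vfE; ring.
have ex : x = u + iF *: v.
  apply: vf_ext => f; rewrite !vfE.
  ring: (ii M) (half2 M).
have ec : vconj x = u - iF *: v.
  apply: vf_ext => f; rewrite !vfE.
  ring: (ii M) (half2 M).
clearbody u v; rewrite ec [in RHS]ex !linearD linearN linearZ /= vconjD vconjZ smooth_conjf_i.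
by rewrite !(vf_real_vconj (cs_real csL _)) // scaleNr.
Qed.

(** Conjugation preserves brackets and, [L] being real, exchanges the two types. *)
Lemma cs_integrable01 x y : type01 L x -> type01 L y -> type01 L (br x y).
Proof.
have conj10 z : type01 L z -> type10 L (vconj z).
  by rewrite /type01 /type10 cs_vconj => ->; rewrite vconjZ smooth_conjfN smooth_conjf_i opprK.
move=> /conj10 tx /conj10 ty; have := cs_integrable csL tx ty.
rewrite /type10 /type01 -vconj_br cs_vconj => /(congr1 vconj).
by rewrite vconjZ !vconjK smooth_conjf_i.
Qed.

(** The Nijenhuis tensor of [L] vanishes. The brackets $[x \mp iLx, y \mp iLy]$ equal $A \mp iB$ and
    have type (1,0) and (0,1) respectively; adding the two eigenvalue equations gives $LA = B$,
    hence $LB = -A$. *)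
Lemma cs_nijenhuis x y : br (L x) (L y) = br x y + L (br (L x) y + br x (L y)).
Proof.
pose A := br x y - br (L x) (L y); pose B := br (L x) y + br x (L y).
have e10 z : type10 L (z - iF *: L z).
  rewrite /type10 linearB linearZ /= (cs_square csL) scalerBr scalerA (ii M).
  by rewrite scalerN opprK scaleN1r opprK addrC.
have e01 z : type01 L (z + iF *: L z).
  rewrite /type01 linearD linearZ /= (cs_square csL) scalerDr scalerA mulNr (ii M).
  by rewrite opprK scale1r scalerN scaleNr addrC.
have eL f : L (A + f *: B) = L A + f *: L B by rewrite linearD linearZ.
have := cs_integrable csL (e10 x) (e10 y).
have -> : br (x - iF *: L x) (y - iF *: L y) = A + (- iF) *: B.
  apply: vf_ext => f; rewrite /A /B !(vfE, vfD, vfN, vfM, vf_const).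
  ring: (ii M).
rewrite /type10 eL => h10.
have := cs_integrable01 (e01 x) (e01 y).
have -> : br (x + iF *: L x) (y + iF *: L y) = A + iF *: B.
  apply: vf_ext => f; rewrite /A /B !(vfE, vfD, vfN, vfM, vf_const).
  ring: (ii M).
rewrite /type01 eL => h01.
have eA : L A = B.
  clearbody A B.
  apply: vf_ext => f.
  have k1 : (L A + iF *: L B) f = (- iF *: (A + iF *: B)) f by rewrite h01.
  have k2 : (L A + (- iF) *: L B) f = (iF *: (A + (- iF) *: B)) f by rewrite h10.
  move: k1 k2; rewrite !vfE => k1 k2.
  have -> : L A f = halfF * ((L A f + - iF * L B f) + (L A f + iF * L B f)).
    by ring: (half2 M).
  by rewrite k1 k2; ring: (ii M) (half2 M).
rewrite -/B -eA (cs_square csL) /A.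
by apply: vf_ext => f; rewrite !vfE; ring.
Qed.

End ComplexStructureTheory.

(** * Exterior derivatives along involutive distributions *)

Section TwistedDifferential.
Variables (R : realType) (M : smooth_manifold R).
Local Notation F := (smooth_fun M).
Local Notation X := (vfield M).
Local Notation T := (cochain M).
Local Notation br := lie_bracket.
Implicit Types (x y : X) (a b : T) (s : seq X).

Lemma act_form (L : {linear X -> X}) k a : is_form k a -> is_form k (act L a).
Proof.
move=> /is_formP[a1 a2 a3]; apply/is_formP; rewrite /act; split.
- by move=> s hs; rewrite a1 ?size_map.
- by move=> s1 s2 f x y; rewrite !map_cat /= linearP a2.
- by move=> s1 s2 x; rewrite map_cat /= a3.
Qed.

Lemma act_wedge (L : X -> X) a b : act L (wedge a b) = wedge (act L a) (act L b).
Proof.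
apply/funext => s; rewrite /act /wedge size_map.
by apply: eq_bigr => m _; rewrite !map_mask.
Qed.

(** Evaluating [rd a] on fields in [E] involves [a] only on those fields and their brackets, which
    stay in [E]. *)
Lemma rd_vanish (E : X -> Prop) a : (forall x y, E x -> E y -> E (br x y)) ->
  (forall s, (forall x, x \in s -> E x) -> a s = 0) ->
  forall s, (forall x, x \in s -> E x) -> rd a s = 0.
Proof.
move=> brE.
have consE y s : (forall x, x \in y :: s -> E x) -> E y /\ forall x, x \in s -> E x.
  by move=> h; split=> [|x xs]; apply: h; rewrite inE ?eqxx // xs orbT.
have Econs y s : E y -> (forall x, x \in s -> E x) -> forall x, x \in y :: s -> E x.
  by move=> Ey Es x; rewrite inE => /orP[/eqP ->|/Es].
have lie_vanish x s b : E x -> (forall y, y \in s -> E y) ->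
    (forall s, (forall x, x \in s -> E x) -> b s = 0) -> lier x s b = 0.
  move=> Ex; elim: s b => [|y s IH] b Es hb /=; first by rewrite hb // vf0.
  have [Ey {}Es] := consE _ _ Es.
  rewrite hb ?subr0; last by apply: Econs => //; exact: brE.
  by apply: IH => // t Et; apply: hb; exact: Econs.
move=> ha s; elim: s a ha => [|x s IH] a ha Es //; have [Ex {}Es] := consE _ _ Es.
rewrite /rd /= /lie lie_vanish // sub0r -[rdr _ _]/(rd (ins x a) s) IH ?oppr0 //.
by move=> t Et; apply: ha; exact: Econs.
Qed.

(** The exterior derivative along the image of [P]: [L] carries the form there, and [P] pulls the
    result back. *)
Definition twisted (P L : X -> X) (a : T) : T := act P (rd (act L a)).

Lemma twisted_form (P L : {linear X -> X}) p a :
  is_form p a -> is_form p.+1 (twisted P L a).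
Proof.
move=> /(act_form L) fa; apply: act_form.
by have [_ m l] := (is_formP _ _).1 fa; rewrite -extdE //; exact: extd_form.
Qed.

Lemma twisted_lin (P L : X -> X) (c : R[i]) a b :
  twisted P L (c *: a + b) = c *: twisted P L a + twisted P L b.
Proof.
rewrite /twisted -[act L (_ + _)]/(c *: act L a + act L b).
have -> : rd (c *: act L a + act L b) = c *: rd (act L a) + rd (act L b).
  by rewrite -rdZ; apply/funext => s; rewrite /rd rdrD.
by [].
Qed.

(** Pullbacks are multiplicative and [rd] is a graded derivation; [sgn] becomes $(-1)^p$ because [a]
    lives on tuples of length [p] only. *)
Lemma twisted_wedge (P L : X -> X) p a b : (forall s, size s <> p -> a s = 0) ->
  act P (act L a) = a -> act P (act L b) = b ->
  twisted P L (wedge a b) =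
  wedge (twisted P L a) b + (-1) ^+ p *: wedge a (twisted P L b).
Proof.
move=> sa ea eb; rewrite /twisted act_wedge.
have -> : rd (wedge (act L a) (act L b)) =
    wedge (rd (act L a)) (act L b) + wedge (sgn (act L a)) (rd (act L b)).
  by apply/funext => s; rewrite fctE !wedgeE -rd_wedge.
rewrite -[act P (_ + _)]/(act P _ + act P _) !act_wedge eb.
have -> : act P (sgn (act L a)) = (-1) ^+ p *: a.
  apply/funext => s; rewrite -[in RHS]ea /act /sgn size_map cmulE /cmul.
  rewrite rmorphXn rmorphN1; have [->//|/eqP np] := eqVneq (size s) p.
  by rewrite sa ?size_map // !mulr0.
by congr (_ + _); apply/funext => s; rewrite !cmulE /cmul !wedgeE wedgeZ1.
Qed.

(* P parametrizes an involutive distribution, on which P \o L is the identity. *)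
Lemma twisted_twisted (P L : {linear X -> X}) p a :
  (forall x, P (L (P x)) = P x) ->
  (forall x y, P (L (br (P x) (P y))) = br (P x) (P y)) ->
  is_form p a -> twisted P L (twisted P L a) = 0.
Proof.
move=> PLP Pbr /(act_form L) /is_formP[_ ma la].
(* The error [c] vanishes on tuples from the distribution, hence so does [rd c] by involutivity;
   what remains is [rd b], which is zero. *)
pose b := rd (act L a); pose c := act L (act P b) - b.
have c0 s : (forall x, x \in s -> P (L x) = x) -> c s = 0.
  move=> hs; rewrite /c !fctE /act -map_comp.
  suff -> : map (P \o L) s = s by rewrite subrr.
  by rewrite -[RHS]map_id; exact/eq_in_map.
have E x y : P (L x) = x -> P (L y) = y -> P (L (br x y)) = br x y.
  by move=> <- <-; rewrite Pbr.
apply/funext => s; rewrite /twisted -/b {1}/act.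
have /(rd_vanish E c0) : forall x, x \in map P s -> P (L x) = x.
  by move=> x /mapP[y _ ->]; exact: PLP.
rewrite /c rd_sub !fctE => /eqP; rewrite subr_eq0 => /eqP ->.
by rewrite /b [LHS]rd_rd.
Qed.

End TwistedDifferential.

(** * Hypercomplex manifolds *)

Section Hypercomplex.
Variables (R : realType) (M : smooth_manifold R) (H : hypercomplex M).
Local Notation F := (smooth_fun M).
Local Notation X := (vfield M).
Local Notation T := (cochain M).
Local Notation I := (hcI H).
Local Notation J := (hcJ H).
Local Notation K := (hcK H).
Local Notation iF := (smooth_const M 'i%C).
Local Notation halfF := (smooth_const M 2^-1).
Local Notation br := lie_bracket.
Local Notation pr := (proj10 H).
Local Notation pr' := (proj01 H).
Implicit Types (x y : X) (a b : T) (s : seq X).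

Fact proj10_linear : linear pr.
Proof.
move=> f x y; rewrite /proj10 linearP; apply: vf_ext => g.
by rewrite !vfE; ring.
Qed.
HB.instance Definition _ := GRing.isLinear.Build F X X _ pr proj10_linear.

(** * $J$ and the types of $I$ and $K$ *)

Lemma J10 x : type10 I x -> type01 I (J x).
Proof.
by rewrite /type10 /type01 (hcIJ_anticomm H) => ->; rewrite linearZ scaleNr.
Qed.

Lemma J01 x : type01 I x -> type10 I (J x).
Proof.
by rewrite /type10 /type01 (hcIJ_anticomm H) => ->; rewrite scaleNr linearN linearZ opprK.
Qed.

Lemma JJ x : J (J x) = - x. Proof. exact: (cs_square (hcJ_complex H)). Qed.

Lemma proj01_id x : type01 I x -> pr' x = x.
Proof.
rewrite /type01 /proj01 => ->.
by rewrite scalerA mulrN ii opprK scale1r scalerDr -scalerDl half2 scale1r.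
Qed.

Lemma proj10_01 x : type01 I x -> pr x = 0.
Proof.
by rewrite /type01 /proj10 => ->; rewrite scalerA mulrN ii opprK scale1r subrr scaler0.
Qed.

Lemma proj10_J x : pr (J x) = J (pr' x).
Proof.
rewrite {1}(proj_sum H x) !linearD /= (proj10_01 (J10 (proj10_type _ _))) add0r.
exact/proj10_id/J01/proj01_type.
Qed.

Lemma proj01_J x : pr' (J x) = J (pr x).
Proof.
have e y : pr' y = y - pr y by rewrite [y in y - _](proj_sum H) addrC addKr.
by rewrite e proj10_J -linearB e opprB addrC subrK.
Qed.

(** The parametrization $x \mapsto -Jx$ of the (0,1)-fields by the (1,0)-fields, extended by zero on
    (0,1)-fields; [J] is its inverse. *)
Definition proj10J x : X := - J (pr x).

Fact proj10J_linear : linear proj10J.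
Proof.
move=> f x y; rewrite /proj10J !linearP; apply: vf_ext => g.
by rewrite !vfE; ring.
Qed.
HB.instance Definition _ := GRing.isLinear.Build F X X _ proj10J proj10J_linear.

(* The projection onto the (1,0)-fields of K along the (0,1)-fields of I. *)
Definition proj10K x : X := pr x - J (pr x).

Fact proj10K_linear : linear proj10K.
Proof.
move=> f x y; rewrite /proj10K !linearP; apply: vf_ext => g.
by rewrite !vfE; ring.
Qed.
HB.instance Definition _ := GRing.isLinear.Build F X X _ proj10K proj10K_linear.

Lemma proj10K_type x : type10 K (proj10K x).
Proof.
rewrite /type10 /proj10K -(hcIJK H) linearB JJ opprK linearD /= (hcIJ_anticomm H).
rewrite (proj10_type H x) linearZ /=.
by apply: vf_ext => g; rewrite !vfE; ring.
Qed.

(** From $IJx = ix$ follow $JIx = -ix$ and $Jx = -iIx$, and $\frac12(x - iIx) - \frac12(Jx - iJIx)$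
    collapses to $x$. *)
Lemma proj10K_id x : type10 K x -> proj10K x = x.
Proof.
move=> tx; have IJx : I (J x) = iF *: x by rewrite (hcIJK H).
have JIx : J (I x) = - iF *: x by rewrite scaleNr -IJx (hcIJ_anticomm H) opprK.
have Jx : J x = - iF *: I x.
  by rewrite scaleNr -[iF *: I x]linearZ /= -IJx (cs_square (hcI_complex H)) opprK.
rewrite /proj10K /proj10 [J (_ *: _)]linearZ [J (_ - _)]linearB [J (_ *: _)]linearZ /= JIx Jx.
by apply: vf_ext => g; rewrite !vfE; ring: (ii M) (half2 M).
Qed.

Lemma proj_type0 a : proj_type H 0 a = act pr' a.
Proof.
apply/funext => s; rewrite /proj_type /act.
rewrite (big_pred1 [tuple of nseq (size s) false]) /=.
  by congr a; elim: s => //= x s ->.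
move=> m; apply/idP/eqP => [|-> /=]; last by rewrite count_nseq.
rewrite eqn0Ngt -has_count -all_predC (@eq_all _ _ (pred1 false)); last by case.
by move=> /all_pred1P h; apply: val_inj; rewrite /= h size_tuple.
Qed.

(** [J] exchanges the two projections, so projecting $-Jx$ to type (0,1) gives [proj10J x]. *)
Lemma dolbJE p a : is_form p a -> dolbJ H a = twisted proj10J J a.
Proof.
move=> /(act_form J) fa; have [_ m l] := (is_formP _ _).1 fa.
rewrite /dolbJ /dolbbar proj_type0 extdE //; apply/funext => s.
rewrite /twisted /act -map_comp; congr (rd _ _); apply: eq_map => x /=.
by rewrite /proj10J -linearN proj01_J !linearN.
Qed.

(** * Comparison of $d + d_J$ with the Dolbeault operator of $K$ *)

Lemma brJ_type10 x y : type10 I x -> type10 I y -> type10 I (J (br (J x) (J y))).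
Proof.
by move=> tx ty; apply/J01/(cs_integrable01 (hcI_complex H)); exact: J10.
Qed.

(* Equivalent to the vanishing of the Nijenhuis tensor of J. *)
Lemma br_subJ x y : br (x - J x) (y - J y) =
  (br x y + J (br (J x) (J y))) - J (br x y + J (br (J x) (J y))).
Proof.
have n := cs_nijenhuis (hcJ_complex H) x y.
have {}n : J (br (J x) (J y)) = J (br x y) - (br (J x) y + br x (J y)).
  by rewrite n linearD /= JJ.
rewrite linearD /= JJ n; apply: vf_ext => f.
by rewrite !(vfE, vfD, vfN); ring.
Qed.

Lemma kills01_sub a s1 s2 x : multi a -> kills01 H a -> type10 I x ->
  a (s1 ++ x - J x :: s2) = a (s1 ++ x :: s2).
Proof.
move=> ma ha tx; rewrite (multiD _ _ _ _ ma) (multiN _ _ _ ma).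
by rewrite (ha s1 s2 _ (J10 tx)) subr0.
Qed.

Lemma kills01_map_sub a s : multi a -> kills01 H a ->
  (forall x, x \in s -> type10 I x) -> a (map (fun x => x - J x) s) = a s.
Proof.
elim: s a => [|x s IH] a ma ha hs //=.
rewrite (kills01_sub [::] _ ma ha) /=; last by apply: hs; rewrite mem_head.
rewrite -[LHS]/(ins x a _) IH //; first exact: multi_ins.
  by move=> s1 s2 y; exact: (ha (x :: s1)).
by move=> y ys; apply: hs; rewrite inE ys orbT.
Qed.

(** By [br_subJ], $[x - Jx, y - Jy] = z - Jz$ with $z = [x,y] + J[Jx,Jy]$ of type (1,0). As [a] does
    not see $Jz$, the two terms of $z$ supply the bracket terms of the two Lie derivatives on the
    right. *)
Lemma lier_subJ x s a : multi a -> kills01 H a -> type10 I x ->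
  (forall y, y \in s -> type10 I y) ->
  lier (x - J x) (map (fun x => x - J x) s) a =
  lier x s a + lier (- J x) (map (fun x => - J x) s) (act J a).
Proof.
move=> ma ha tx; elim: s a ma ha => [|y s IH] a ma ha hs /=; first by [].
have ty : type10 I y by apply: hs; rewrite mem_head.
have {}hs z : z \in s -> type10 I z by move=> zs; apply: hs; rewrite inE zs orbT.
have hi : kills01 H (ins y a) by move=> s1 s2 z; exact: (ha (y :: s1)).
have -> : ins (y - J y) a = ins y a.
  by apply/funext => t; exact: (kills01_sub [::]).
have -> : ins (- J y) (act J a) = act J (ins y a).
  by apply/funext => t; rewrite /ins /act /= linearN JJ opprK.
rewrite IH //; last exact: multi_ins.
(* On the tail [s], $J$ undoes $-J$. *)
have -> : act J a (br (- J x) (- J y) :: map (fun x => - J x) s) =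
    a (J (br (J x) (J y)) :: s).
  rewrite /act /= -map_comp (_ : map _ s = s).
    suff -> : br (- J x) (- J y) = br (J x) (J y) by [].
    by apply: vf_ext => f; rewrite !(vfE, vfN) !opprK.
  rewrite -[RHS]map_id; apply: eq_map => z /=.
  by rewrite linearN JJ opprK.
have t1 := cs_integrable (hcI_complex H) tx ty; have t2 := brJ_type10 tx ty.
have t12 : type10 I (br x y + J (br (J x) (J y))).
  by rewrite /type10 linearD /= t1 t2 scalerDr.
rewrite br_subJ (kills01_sub [::] _ ma ha t12) /=.
rewrite -[a (_ :: map _ s)]/(ins (br x y + J (br (J x) (J y))) a _).
rewrite kills01_map_sub //; last first.
- by move=> s1 s2 z; exact: (ha (_ :: s1)).
- exact: multi_ins.
rewrite /ins (multiD [::] _ _ _ ma) /=; ring.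
Qed.

Lemma rdr_subJ s a : multi a -> kills01 H a -> (forall x, x \in s -> type10 I x) ->
  rdr (map (fun x => x - J x) s) a =
  rdr s a + rdr (map (fun x => - J x) s) (act J a).
Proof.
elim: s a => [|x s IH] a ma ha hs /=; first by rewrite addr0.
have tx : type10 I x by apply: hs; rewrite mem_head.
have {}hs z : z \in s -> type10 I z by move=> zs; apply: hs; rewrite inE zs orbT.
have -> : ins (x - J x) a = ins x a.
  by apply/funext => t; exact: (kills01_sub [::]).
have -> : ins (- J x) (act J a) = act J (ins x a).
  by apply/funext => t; rewrite /ins /act /= linearN JJ opprK.
rewrite IH //; [|exact: multi_ins|by move=> s1 s2 z; exact: (ha (x :: s1))].
by rewrite /lie lier_subJ //; ring.
Qed.

(* On A^{p,0}, d + d_J is the Dolbeault operator of K, transported along the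
   isomorphism x |-> x - J x from the (1,0)-fields of I to those of K. *)
Lemma dolb_add_dolbJ p a : bidegree H p 0 a ->
  dolb H p a + dolbJ H a = twisted proj10K idfun a.
Proof.
move=> ha; have fa := bidegree0_form ha; have [_ ma _] := (is_formP _ _).1 fa.
rewrite dolbE // (dolbJE fa); apply/funext => s.
rewrite -[LHS]/(rdr (map pr s) a + rdr (map proj10J s) (act J a)).
rewrite -[RHS]/(rdr (map proj10K s) (act idfun a)).
have -> : act idfun a = a by apply/funext => t; rewrite /act map_id.
have -> : map proj10J s = map (fun x => - J x) (map pr s) by rewrite -map_comp.
have -> : map proj10K s = map (fun x => x - J x) (map pr s) by rewrite -map_comp.
rewrite [RHS]rdr_subJ //; first exact: bidegree_kills01 ha.
by move=> x /mapP[y _ ->]; exact: proj10_type.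
Qed.

(** This is $(d + d_J)^2 = 0$: [proj10K] projects onto the (1,0)-fields of $K$, which are involutive
    as $K$ is integrable. *)
Lemma twistedK0 p a : bidegree H p 0 a ->
  twisted proj10K idfun (twisted proj10K idfun a) = 0.
Proof.
move=> /bidegree0_form fa; apply: (twisted_twisted _ _ fa) => /= [x|x y].
  by rewrite proj10K_id //; exact: proj10K_type.
apply: proj10K_id; apply: (cs_integrable (hcK_complex H)); exact: proj10K_type.
Qed.

Lemma proj10J_kills x : type01 I x -> proj10J x = 0.
Proof. by move=> tx; rewrite /proj10J proj10_01 // linear0 oppr0. Qed.

Lemma dolbJ_bidegree p a : bidegree H p 0 a -> bidegree H p.+1 0 (dolbJ H a).
Proof.
move=> /bidegree0_form fa; rewrite (dolbJE fa).
have fJ : is_form p.+1 (twisted proj10J J a) by exact: twisted_form fa.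
apply: kills01_bidegree => // s1 s2 x tx.
rewrite /twisted /act map_cat /= proj10J_kills // multi0 //.
by have /is_formP[] := extd_form (act_form J fa); rewrite extdE //;
  have /is_formP[] := act_form J fa.
Qed.

(** The distribution here is that of the (0,1)-fields of $I$, involutive by [cs_integrable01]. *)
Lemma dolbJ_dolbJ p a : bidegree H p 0 a -> dolbJ H (dolbJ H a) = 0.
Proof.
move=> ha; have fa := bidegree0_form ha.
rewrite (dolbJE (bidegree0_form (dolbJ_bidegree ha))) (dolbJE fa).
have J01' x : type01 I x -> proj10J (J x) = x.
  by move=> tx; rewrite /proj10J proj10_J proj01_id // JJ opprK.
have tJ x : type01 I (proj10J x).
  rewrite /proj10J -linearN -[- pr x]linearN /=; exact/J10/proj10_type.
apply: (twisted_twisted _ _ fa) => [x|x y]; first exact: J01'.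
apply: J01'; exact: (cs_integrable01 (hcI_complex H)).
Qed.

Lemma dolbJ_lin p (c : R[i]) a b : bidegree H p 0 a -> bidegree H p 0 b ->
  dolbJ H (c *: a + b) = c *: dolbJ H a + dolbJ H b.
Proof.
move=> ha hb; have /p0P/bidegree0_form fab : c *: a + b \in p0_pred H p.
  by have [_ h] := p0_submod H p; apply: h; apply/p0P.
rewrite (dolbJE fab) (dolbJE (bidegree0_form ha)) (dolbJE (bidegree0_form hb)).
exact: twisted_lin.
Qed.

Lemma dolbJ_wedge p q a b : bidegree H p 0 a -> bidegree H q 0 b ->
  dolbJ H (wedge a b) =
  wedge (dolbJ H a) b + (-1) ^+ p *: wedge a (dolbJ H b).
Proof.
move=> ha hb; have fa := bidegree0_form ha; have fb := bidegree0_form hb.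
rewrite (dolbJE (wedge_form fa fb)) (dolbJE fa) (dolbJE fb).
(* Since $J(-J \, \mathrm{pr}\, x) = \mathrm{pr}\, x$, the composite pullback is [pb10], which fixes
   $(r,0)$-forms. *)
have eJ r c : bidegree H r 0 c -> act proj10J (act J c) = c.
  move=> hc; rewrite -[RHS](bidegree_pb10 hc); apply/funext => s.
  rewrite /act /pb10 -map_comp; congr c; apply: eq_map => x /=.
  by rewrite /proj10J linearN JJ opprK.
by apply: twisted_wedge; [exact: form_size fa|exact: eJ ha|exact: eJ hb].
Qed.

(** Expand $(d + d_J)^2 = 0$ and remove $d^2 = d_J^2 = 0$. *)
Lemma dolb_dolbJ p a : bidegree H p 0 a ->
  dolb H p.+1 (dolbJ H a) = - dolbJ H (dolb H p a).
Proof.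
move=> ha; have hd := dolb_bidegree ha; have hJ := dolbJ_bidegree ha.
have hdJ : bidegree H p.+1 0 (dolb H p a + dolbJ H a).
  apply/p0P; have [_ h] := p0_submod H p.+1; rewrite -[dolb _ _ _]scale1r.
  by apply: h; exact/p0P.
have := twistedK0 ha; rewrite -(dolb_add_dolbJ ha) -(dolb_add_dolbJ hdJ).
rewrite -[dolb H p a]scale1r (dolbP _ hd hJ) (dolbJ_lin _ hd hJ) !scale1r.
by rewrite (dolb_dolb ha) (dolbJ_dolbJ ha) add0r addr0 => /eqP; rewrite addr_eq0 => /eqP.
Qed.

(** Leibniz on $1 = 1 \wedge 1$ gives $d_J 1 = d_J 1 + d_J 1$. *)
Lemma dolbJ_one : dolbJ H (@cochain_one R M) = 0.
Proof.
have h1 := one_bidegree H; have := dolbJ_wedge h1 h1.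
rewrite !wedge_onel wedge_oner expr0 scale1r => /eqP.
by rewrite -subr_eq0 opprD addNKr oppr_eq0 => /eqP.
Qed.

(** * The algebra $A^{\bullet,0}(M)$ with both differentials *)

Definition p0_dolbJ p (a : p0_form H p) : p0_form H p.+1 :=
  P0Form (introT (p0P _ _ _) (dolbJ_bidegree (p0_form_bidegree a))).

Definition hypercomplex_bidga : bidga R[i].
Proof.
refine (@BiDGA _ (dolbeault_dga H) p0_dolbJ _ _ _ _ _).
- move=> p c x y; apply: val_inj.
  exact: dolbJ_lin (p0_form_bidegree x) (p0_form_bidegree y).
- by move=> p x; apply: val_inj; exact: dolbJ_dolbJ (p0_form_bidegree x).
- by apply: val_inj; exact: dolbJ_one.
- move=> p q x y; apply: val_inj; rewrite addrC.
  rewrite -[RHS]/((-1) ^+ p *: val (ecast n (p0_form H n) (addnS p q)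
    (p0_wedge x (p0_dolbJ y))) + wedge (dolbJ H (val x)) (val y)) p0_cast addrC.
  exact: dolbJ_wedge (p0_form_bidegree x) (p0_form_bidegree y).
- by move=> p x; apply: val_inj; exact: dolb_dolbJ (p0_form_bidegree x).
Defined.

Let A := hypercomplex_bidga.

(** This lemma and the next two translate between coboundaries in the algebra and the sets of
    cochains in [ddJ_lemma]. *)
Lemma coboundary_Im p (x : A p) : coboundary x -> Im_dolb H p (val (x : p0_form H p)).
Proof.
case: p x => [|p] x /= => [->|[y ->]] //.
by exists (val (y : p0_form H p)) => //; exact: p0_form_bidegree.
Qed.

Lemma coboundaryJ_Im p (x : A p) : coboundaryJ x -> Im_dolbJ H p (val (x : p0_form H p)).
Proof.
case: p x => [|p] x /= => [->|[y ->]] //.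
by exists (val (y : p0_form H p)) => //; exact: p0_form_bidegree.
Qed.

Lemma Im_coboundary2 p (x : A p) :
  Im_dolb_dolbJ H p (val (x : p0_form H p)) -> coboundary2 x.
Proof.
case: p x => [|[|p]] x /= => [e|e|[b /p0P hb e]]; try exact: val_inj.
by exists (P0Form hb); apply: val_inj; rewrite /= -e.
Qed.

End Hypercomplex.

Theorem theorem1p2 (R : realType) (M : smooth_manifold R) (H : hypercomplex M)
    (M_compact : compact [set: M]) (M_ddJ : ddJ_lemma H) :
  formal (dolbeault_dga H).
Proof.
apply: (@bidga_formal _ (hypercomplex_bidga H)) => p x bx dx;
  apply: Im_coboundary2; have [e1 e2] := M_ddJ p.
  by rewrite -e1; split; [exact: coboundary_Im|exact: (congr1 (@p0_val _ _ H _) dx)].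
by rewrite -e2; split; [exact: coboundaryJ_Im|exact: (congr1 (@p0_val _ _ H _) dx)].
Qed.
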